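(* Let $(A,\sigma)$ be an $F$-algebra with involution and $P\in X_F\setminus\mathrm{Nil}[A,\sigma]$. Let $\iota_1:F\to L_1$ and $\iota_2:F\to L_2$ be two real closures of $F$ at $P$, and let $\mathscr{M}_1$ and $\mathscr{M}_2$ be two different Morita equivalences, $\mathscr{M}_k$ being a Morita equivalence from $\mathscr{H}(A\otimes_F L_k,\sigma\otimes\mathrm{id})$ (tensor product along $\iota_k$) to the corresponding category $\mathscr{H}_{\varepsilon_P}(D_P,\vartheta_P)$ for the real closure $\iota_k$ ($k=1,2$). Let $h_0\in W(A,\sigma)$ be such that $\mathrm{sign}_{\iota_1}^{\mathscr{M}_1}h_0\neq0$ and let $\delta_k\in\{-1,1\}$ be the sign of $\mathrm{sign}_{\iota_k}^{\mathscr{M}_k}h_0$ for $k=1,2$. Then $$\delta_1\,\mathrm{sign}_{\iota_1}^{\mathscr{M}_1}h=\delta_2\,\mathrm{sign}_{\iota_2}^{\mathscr{M}_2}h$$ for all $h\in W(A,\sigma)$.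
   Context: **Algebras with involution and forms.** $F$ is a formally real field and $X_F$ is its space of orderings. An $F$-algebra with involution is a pair $(A,\sigma)$ with $A$ a finite-dimensional $F$-algebra and $\sigma:A\to A$ an $F$-linear map with $\sigma(xy)=\sigma(y)\sigma(x)$, $\sigma^2=\mathrm{id}$, such that either ($\sigma$ of the first kind) $A$ is simple with centre $F$, or ($\sigma$ of the second kind, or unitary) $A$ is simple with centre a quadratic field extension $F(\sqrt d)$ of $F$ on which $\sigma$ acts nontrivially. If $\sigma$ is of the first kind and $\dim_F A=m^2$, then $\sigma$ is orthogonal (resp. symplectic) if $\{a\in A:\sigma(a)=a\}$ has $F$-dimension $m(m+1)/2$ (resp. $m(m-1)/2$). For $\varepsilon\in\{-1,1\}$, an $\varepsilon$-hermitian form over a ring with involution $(A,\sigma)$ is a finitely generated right module $M$ (always projective here) with a biadditive $h:M\times M\to A$ such that $h(xa,yb)=\sigma(a)h(x,y)b$ and $h(y,x)=\varepsilon\sigma(h(x,y))$; hermitian means $\varepsilon=1$. All forms are assumed nonsingular. $\mathscr{H}_\varepsilon(A,\sigma)$ is the category of nonsingular $\varepsilon$-hermitian forms with isometries as morphisms, $W_\varepsilon(A,\sigma)$ the Witt group; the subscript is dropped when $\varepsilon=1$. **Signatures, real closed case.** Let $R$ be real closed. For a symmetric bilinear form over $R$, a hermitian form over $(R(\sqrt{-1}),-)$ (conjugation), or a hermitian form over $((-1,-1)_R,-)$ (quaternion conjugation), diagonalize as $\langle\alpha_1,\dots,\alpha_n\rangle$ with $\alpha_i\in\{-1,1\}$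 and put $\mathrm{sign}=\sum\alpha_i$. For skew-symmetric forms over $R$, hermitian forms over $(R\times R,\text{exchange involution }(x,y)\mapsto(y,x))$ and skew-hermitian forms over $((-1,-1)_R,-)$, put $\mathrm{sign}=0$. **$M$-signature.** A real closure of $F$ at $P$ is a field embedding $\iota:F\to F_P$ with $F_P$ real closed, $\iota(P)\subseteq F_P^2$ and $F_P$ algebraic over $\iota(F)$. Tensor products with $F_P$ are along $\iota$. The algebra with involution $(A\otimes_F F_P,\sigma\otimes\mathrm{id})$ is (hermitian) Morita equivalent to $(D_P,\vartheta_P)$, where: if $\sigma$ is of the first kind, $(D_P,\vartheta_P)=(F_P,\mathrm{id})$ or $(H_P,-)$ with $H_P=(-1,-1)_{F_P}$, according to whether $A\otimes_F F_P$ is a matrix algebra over $F_P$ or over $H_P$; if $\sigma$ is unitary, $(D_P,\vartheta_P)=(F_P(\sqrt{-1}),-)$ if $d<_P0$ and $(F_P\times F_P,\text{exchange})$ if $d>_P0$. Put $\varepsilon_P=-1$ if one of $\sigma,\vartheta_P$ is orthogonal and the other symplectic ($\mathrm{id}$ on $F_P$ being orthogonal and $-$ on $H_P$ symplectic), $\varepsilon_P=1$ otherwise. A Morita equivalence $\mathscr{M}:\mathscr{H}(A\otimes_F F_P,\sigma\otimes\mathrm{id})\to\mathscr{H}_{\varepsilon_P}(D_P,\vartheta_P)$ is an equivalence of categories given by hermitian Morita theory; it respects isometries, orthogonal sums and hyperbolic forms and induces a group isomorphism of Witt groups, also denoted $\mathscr{M}$. For a hermitian form $h$ over $(A,\sigma)$,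 $\mathrm{sign}_\iota^{\mathscr{M}}h:=\mathrm{sign}\,\mathscr{M}(h\otimes F_P)$, where $h\otimes F_P=(\mathrm{id}_A\otimes\iota)^*(h)$. **Nil-orderings.** $\mathrm{Nil}[A,\sigma]$ is the set of $P\in X_F$ with $D_P=H_P$ if $\sigma$ is orthogonal, $D_P=F_P$ if $\sigma$ is symplectic, $D_P=F_P\times F_P$ if $\sigma$ is unitary. *)

(* Defs.v *)
From HB Require Import structures.
From mathcomp Require Import all_boot all_order all_algebra all_field.
From mathcomp Require Import complex.
From mathcomp Require Import ring.
From mathcomp Require Import boolp classical_sets.

Set Implicit Arguments.
Unset Strict Implicit.
Unset Printing Implicit Defensive.

Import Order.TTheory GRing.Theory Num.Theory.

Local Open Scope ring_scope.
Local Open Scope quotient_scope.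

(* A right R-module is a left module over the converse ring R^c. *)
Notation rmodType R := (lmodType (R : pzRingType)^c).

Definition rscale (R : pzRingType) (M : rmodType R) (x : M) (a : R) : M :=
  (a : R^c) *: x.

Notation "x *> a" := (rscale x a) (at level 40, left associativity).

Notation regr R := ((R : pzRingType)^c^o).

Lemma rscale1 (R : pzRingType) (M : rmodType R) (x : M) : x *> 1 = x.
Proof. by rewrite /rscale scale1r. Qed.

Lemma rscaleDl (R : pzRingType) (M : rmodType R) (x y : M) a :
  (x + y) *> a = x *> a + y *> a.
Proof. exact: scalerDr. Qed.

Lemma linear_rscale (R : pzRingType) (M N : rmodType R)
  (f : {linear M -> N}) x a : f (x *> a) = f x *> a.
Proof. exact: linearZ. Qed.

Definition fg_projective (R : pzRingType) (M : rmodType R) : Prop :=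
  exists n (i : {linear M -> 'rV[R^c]_n}) (p : {linear 'rV[R^c]_n -> M}),
    cancel i p.

Record involution (R : pzRingType) := Involution {
  inv_fun :> R -> R;
  invD : {morph inv_fun : x y / x + y};
  invM : forall x y, inv_fun (x * y) = inv_fun y * inv_fun x;
  invK : involutive inv_fun
}.

Section InvolutionTheory.
Variables (R : pzRingType) (s : involution R).

Lemma inv0 : s 0 = 0.
Proof. by apply: (addrI (s 0)); rewrite -invD !addr0. Qed.

Lemma invN x : s (- x) = - s x.
Proof. by apply: (addrI (s x)); rewrite -invD !subrr inv0. Qed.

Lemma inv1 : s 1 = 1.
Proof. by rewrite -[LHS]mulr1 -{2}[1](invK s) -invM mulr1 invK. Qed.

End InvolutionTheory.

(* The sign epsilon of an epsilon-hermitian form is (-1) ^+ e: hermitian forms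
   have e = false and skew-hermitian forms have e = true. *)
Record hform (R : pzRingType) (s : involution R) (e : bool) := HForm {
  hmod : rmodType R;
  hval :> hmod -> hmod -> R;
  hform_proj : fg_projective hmod;
  hformDl : forall x y z, hval (x + y) z = hval x z + hval y z;
  hformDr : forall x y z, hval x (y + z) = hval x y + hval x z;
  hformZ : forall x y a b, hval (x *> a) (y *> b) = s a * hval x y * b;
  hformC : forall x y, hval y x = (-1) ^+ e * s (hval x y);
  hform_nonsing : forall f : {linear hmod -> regr R},
    exists! x, forall y, f y = hval x y
}.

Section HFormTheory.
Variables (R : pzRingType) (s : involution R) (e : bool).

(* A sesquilinear form with a dual basis is a nonsingular form on a finitely
   generated projective module. *)
Definition dual_basis (M : rmodType R) (h : M -> M -> R) : Prop :=
  exists (I : finType) (u v : I -> M), forall m, m = \sum_i u i *> h (v i) m.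

Section Build.
Variables (M : rmodType R) (h : M -> M -> R).
Hypothesis hDl : forall x y z, h (x + y) z = h x z + h y z.
Hypothesis hDr : forall x y z, h x (y + z) = h x y + h x z.
Hypothesis hZ : forall x y a b, h (x *> a) (y *> b) = s a * h x y * b.
Hypothesis hC : forall x y, h y x = (-1) ^+ e * s (h x y).
Hypothesis hdb : dual_basis h.

Let hZr x y b : h x (y *> b) = h x y * b.
Proof. by have := hZ x y 1 b; rewrite inv1 mul1r rscale1. Qed.

Let hZl x y a : h (x *> a) y = s a * h x y.
Proof. by have := hZ x y a 1; rewrite mulr1 rscale1. Qed.

Let h0l x : h 0 x = 0.
Proof. by apply: (addrI (h 0 x)); rewrite -hDl !addr0. Qed.

Lemma dual_basis_proj : fg_projective M.
Proof.
have [I [u [v huv]]] := hdb.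
pose c (m : M) : 'rV[R^c]_#|I| := \row_i (h (v (enum_val i)) m : R^c).
have c_lin : linear c.
  move=> a x y; apply/rowP=> i; rewrite !mxE hDr; congr (_ + _).
  exact: (hZr _ x a).
pose d (r : 'rV[R^c]_#|I|) : M := \sum_i r 0 i *: u (enum_val i).
have d_lin : linear d.
  move=> a x y; rewrite /d scaler_sumr -big_split /=.
  by apply: eq_bigr => i _; rewrite !mxE scalerDl scalerA.
pose cl : {linear M -> 'rV[R^c]_#|I|} :=
  HB.pack c (GRing.isLinear.Build R^c M 'rV[R^c]_#|I| _ c c_lin).
pose dl : {linear 'rV[R^c]_#|I| -> M} :=
  HB.pack d (GRing.isLinear.Build R^c 'rV[R^c]_#|I| M _ d d_lin).
exists #|I|, cl, dl => m; rewrite /= /d [RHS](huv m).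
rewrite [RHS](reindex (fun i : 'I_#|I| => enum_val i)) /=.
  by apply: eq_bigr => i _; rewrite mxE.
by apply: onW_bij; exists enum_rank; [apply: enum_valK|apply: enum_rankK].
Qed.

Lemma dual_basis_nonsing (f : {linear M -> regr R}) :
  exists! x, forall y, f y = h x y.
Proof.
have [I [u [v huv]]] := hdb.
have hsuml (J : Type) (r : seq J) (F : J -> M) y :
    h (\sum_(j <- r) F j) y = \sum_(j <- r) h (F j) y.
  by elim/big_rec2: _ => [|j a b _ <-]; rewrite ?h0l ?hDl.
have fP y : f y = h (\sum_i v i *> s (f (u i))) y.
  rewrite {1}(huv y) linear_sum hsuml; apply: eq_bigr => i _.
  by rewrite /rscale linearZ hZl invK.
exists (\sum_i v i *> s (f (u i))); split=> [//|x xf].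
rewrite [LHS]huv [RHS]huv; apply: eq_bigr => i _; congr (_ *> _).
by rewrite hC -fP xf -hC.
Qed.

Definition build_hform : hform s e :=
  HForm dual_basis_proj hDl hDr hZ hC dual_basis_nonsing.

End Build.

Section Theory.
Variable h : hform s e.

Lemma hform0r (x : hmod h) : h x 0 = 0.
Proof. by apply: (addrI (h x 0)); rewrite -hformDr !addr0. Qed.

Lemma hform0l (x : hmod h) : h 0 x = 0.
Proof. by apply: (addrI (h 0 x)); rewrite -hformDl !addr0. Qed.

Lemma hformZr (x y : hmod h) b : h x (y *> b) = h x y * b.
Proof. by have := hformZ x y 1 b; rewrite inv1 mul1r rscale1. Qed.

Lemma hformZl (x y : hmod h) a : h (x *> a) y = s a * h x y.
Proof. by have := hformZ x y a 1; rewrite mulr1 rscale1. Qed.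

Lemma hform_dual_basis : dual_basis h.
Proof.
have [n [i [p ipK]]] := hform_proj h.
pose c (j : 'I_n) (m : hmod h) : regr R := i m 0 j.
have c_lin j : linear (c j) by move=> a x y; rewrite /c linearP !mxE.
pose cl j : {linear hmod h -> regr R} :=
  HB.pack (c j) (GRing.isLinear.Build R^c (hmod h) (regr R) _ (c j) (c_lin j)).
have /boolp.choice[v vP] : forall j, exists x, forall y, cl j y = h x y.
  by move=> j; have [x [xP _]] := hform_nonsing (cl j); exists x.
exists 'I_n, (fun j => p (delta_mx 0 j)), v => m.
rewrite -{1}(ipK m) {1}[i m]row_sum_delta linear_sum; apply: eq_bigr => j _.
by rewrite linearZ -vP.
Qed.

End Theory.

Record isometry (h h' : hform s e) := Isometry {
  iso_fun :> {linear hmod h -> hmod h'};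
  iso_bij : bijective iso_fun;
  iso_val : forall x y, h' (iso_fun x) (iso_fun y) = h x y
}.

Definition iso_id (h : hform s e) : isometry h h :=
  @Isometry h h idfun (Bijective (frefl _) (frefl _)) (fun _ _ => erefl).

Definition iso_comp (h1 h2 h3 : hform s e)
    (g : isometry h2 h3) (f : isometry h1 h2) : isometry h1 h3 :=
  @Isometry h1 h3 (g \o f) (bij_comp (iso_bij g) (iso_bij f))
    (fun x y => etrans (iso_val g (f x) (f y)) (iso_val f x y)).

Section Sum.
Variables h h' : hform s e.

Definition hsum_val (x y : hmod h * hmod h') : R := h x.1 y.1 + h' x.2 y.2.

Lemma hsumDl x y z : hsum_val (x + y) z = hsum_val x z + hsum_val y z.
Proof. by rewrite /hsum_val !hformDl addrACA. Qed.

Lemma hsumDr x y z : hsum_val x (y + z) = hsum_val x y + hsum_val x z.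
Proof. by rewrite /hsum_val !hformDr addrACA. Qed.

Lemma hsumZ (x y : hmod h * hmod h') a b :
  hsum_val (x *> a) (y *> b) = s a * hsum_val x y * b.
Proof. by rewrite /hsum_val mulrDr mulrDl -!hformZ. Qed.

Lemma hsumC x y : hsum_val y x = (-1) ^+ e * s (hsum_val x y).
Proof. by rewrite /hsum_val invD mulrDr -!hformC. Qed.

Lemma hsum_dual_basis : @dual_basis (hmod h * hmod h')%type hsum_val.
Proof.
have [I [u [v uv]]] := hform_dual_basis h.
have [J [u' [v' uv']]] := hform_dual_basis h'.
exists (I + J)%type,
  (fun k => match k with inl i => (u i, 0) | inr j => (0, u' j) end),
  (fun k => match k with inl i => (v i, 0) | inr j => (0, v' j) end).
move=> [m m']; rewrite big_sumType /= /hsum_val /=.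
rewrite (eq_bigr (fun i => (u i *> h (v i) m, 0))); last first.
  by move=> i _; rewrite hform0l addr0; congr (_, _); apply: scaler0.
rewrite [X in _ + X](eq_bigr (fun i => (0, u' i *> h' (v' i) m'))); last first.
  by move=> i _; rewrite hform0l add0r; congr (_, _); apply: scaler0.
have l (x : hmod h) (y : hmod h') : (x, y) = (x, 0) + (0, y).
  by congr (_, _); rewrite /= ?addr0 ?add0r.
rewrite [LHS]l; congr (_ + _).
  by rewrite {1}(uv m); elim/big_rec2: _ => // i x y _ <-; congr (_, _);
     rewrite /= addr0.
by rewrite {1}(uv' m'); elim/big_rec2: _ => // i x y _ <-; congr (_, _);
   rewrite /= addr0.
Qed.

Definition hsum : hform s e :=
  build_hform hsumDl hsumDr hsumZ hsumC hsum_dual_basis.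

End Sum.

(* W is a model of the dual of U, made into a right module through s, with b
   the evaluation pairing; the form on U x W below is the hyperbolic form
   on U. *)
Definition is_dual_pairing (U W : rmodType R) (b : W -> U -> R) : Prop :=
  [/\ forall w w' u, b (w + w') u = b w u + b w' u,
      forall w u u', b w (u + u') = b w u + b w u',
      forall w u a c, b (w *> a) (u *> c) = s a * b w u * c
    & forall f : {linear U -> regr R}, exists! w, forall u, f u = b w u].

Definition hyperbolic (h : hform s e) : Prop :=
  exists (U W : rmodType R) (b : W -> U -> R),
    [/\ fg_projective U, is_dual_pairing b &
      exists phi : {linear hmod h -> (U * W)%type}, bijective phi /\
        forall x y, h x y = b (phi x).2 (phi y).1 +
                            (-1) ^+ e * s (b (phi y).2 (phi x).1)].

Definition witt_equiv (h h' : hform s e) : Prop :=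
  exists k k' : hform s e, [/\ hyperbolic k, hyperbolic k' &
    inhabited (isometry (hsum h k) (hsum h' k'))].

(* An element of the Witt group, as a Witt class of forms; every element of the
   group is of this kind, the opposite of the class of h being that of -h. *)
Record witt := Witt {
  witt_class :> hform s e -> Prop;
  witt_classP : exists h, forall h', witt_class h' <-> witt_equiv h h'
}.

End HFormTheory.

Lemma isometry_eq (R : pzRingType) (s : involution R) (e : bool)
  (h h' : hform s e) (f g : isometry h h') : f =1 g -> f = g.
Proof.
case: f g => [f fb fv] [g gb gv] /= /funext fg.
have {}fg : f = g.
  case: f g fg {fb fv gb gv} => [f fc] [g gc] /= fg; subst g.
  congr GRing.Linear.Pack; case: fc gc => [[f1] [f2]] [[g1] [g2]].
  by rewrite (Prop_irrelevance f1 g1) (Prop_irrelevance f2 g2).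
subst g; by rewrite (Prop_irrelevance fb gb) (Prop_irrelevance fv gv).
Qed.

Record hfunctor (R : pzRingType) (s : involution R) (e : bool)
    (R' : pzRingType) (s' : involution R') (e' : bool) := HFunctor {
  fobj :> hform s e -> hform s' e';
  fmor : forall h h' : hform s e,
    isometry h h' -> isometry (fobj h) (fobj h');
  fmor_id : forall h, fmor (iso_id h) = iso_id (fobj h);
  fmor_comp : forall (h1 h2 h3 : hform s e)
      (g : isometry h2 h3) (f : isometry h1 h2),
    fmor (iso_comp g f) = iso_comp (fmor g) (fmor f)
}.

Arguments fmor {R s e R' s' e'} _ {h h'}.

Definition hfunctor_id (R : pzRingType) (s : involution R) (e : bool) :
    hfunctor s e s e :=
  @HFunctor R s e R s e id (fun _ _ f => f)
    (fun _ => erefl) (fun _ _ _ _ _ => erefl).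

Section Functors.
Variables (R : pzRingType) (s : involution R) (e : bool).
Variables (R' : pzRingType) (s' : involution R') (e' : bool).

Section Comp.
Variables (R'' : pzRingType) (s'' : involution R'') (e'' : bool).
Variables (G : hfunctor s' e' s'' e'') (F : hfunctor s e s' e').

Lemma hfunctor_comp_id (h : hform s e) :
  fmor G (fmor F (iso_id h)) = iso_id (G (F h)).
Proof. by rewrite !fmor_id. Qed.

Lemma hfunctor_comp_comp (h1 h2 h3 : hform s e)
    (g : isometry h2 h3) (f : isometry h1 h2) :
  fmor G (fmor F (iso_comp g f)) =
  iso_comp (fmor G (fmor F g)) (fmor G (fmor F f)).
Proof. by rewrite !fmor_comp. Qed.

Definition hfunctor_comp : hfunctor s e s'' e'' :=
  @HFunctor R s e R'' s'' e'' (fun h => G (F h))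
    (fun _ _ f => fmor G (fmor F f)) hfunctor_comp_id hfunctor_comp_comp.

End Comp.

(* All morphisms are isometries, hence invertible, so every natural
   transformation is a natural isomorphism. *)
Definition nat_iso (F G : hfunctor s e s' e') : Prop :=
  exists eta : forall h, isometry (F h) (G h),
    forall (h h' : hform s e) (f : isometry h h'),
      iso_comp (fmor G f) (eta h) = iso_comp (eta h') (fmor F f).

End Functors.

Definition is_equivalence (R : pzRingType) (s : involution R) (e : bool)
    (R' : pzRingType) (s' : involution R') (e' : bool)
    (F : hfunctor s e s' e') : Prop :=
  exists G : hfunctor s' e' s e,
    nat_iso (hfunctor_comp G F) (hfunctor_id s e) /\
    nat_iso (hfunctor_comp F G) (hfunctor_id s' e').

(* The tensor product M (x)_R N of a right R-module M and a left R-module N,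
   whose R-actions are given by the functions ra and la. The action on N
   commutes with a further action of a ring T, which is inherited by the
   tensor product. Elements are classes of formal sums of pairs (m, n). *)
Section Tensor.
Variables (R : Type) (T : pzRingType) (M : zmodType) (N : lmodType T).
Variables (ra : M -> R -> M) (la : R -> {linear N -> N}).

Implicit Types (s t : seq (M * N)).

Inductive tens_eq : seq (M * N) -> seq (M * N) -> Prop :=
| TensRefl s : tens_eq s s
| TensSym s t : tens_eq s t -> tens_eq t s
| TensTrans s t u : tens_eq s t -> tens_eq t u -> tens_eq s u
| TensCat s s' t t' : tens_eq s s' -> tens_eq t t' ->
    tens_eq (s ++ t) (s' ++ t')
| TensPerm s t : perm_eq s t -> tens_eq s t
| Tens0l n : tens_eq [:: (0, n)] [::]
| TensDl m m' n : tens_eq [:: (m + m', n)] [:: (m, n); (m', n)]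
| TensDr m n n' : tens_eq [:: (m, n + n')] [:: (m, n); (m, n')]
| TensBal m r n : tens_eq [:: (ra m r, n)] [:: (m, la r n)].

Definition tens_eqb : rel (seq (M * N)) := fun s t => `[< tens_eq s t >].

Lemma tens_eqb_equiv : equiv_class_of tens_eqb.
Proof.
apply: EquivClass => [s|s t|t s u].
- exact/asboolP/TensRefl.
- by apply/asboolP/asboolP; apply: TensSym.
- by move=> /asboolP st /asboolP tu; apply/asboolP; apply: TensTrans st tu.
Qed.

Canonical tens_equiv_rel := EquivRelPack tens_eqb_equiv.

Definition tens := {eq_quot tens_eqb}.
HB.instance Definition _ := Choice.on tens.
HB.instance Definition _ := EqQuotient.on tens.

Lemma tens_piP s t : tens_eq s t <-> \pi_tens s = \pi_tens t.
Proof.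
by split=> [st|/eqmodP/asboolP//]; apply/eqmodP/asboolP.
Qed.

Lemma tens_repr s : tens_eq (repr (\pi_tens s)) s.
Proof. by apply/tens_piP; rewrite reprK. Qed.

Definition tens_add (x y : tens) : tens := \pi_tens (repr x ++ repr y).
Definition tens_opps s := [seq (- p.1, p.2) | p <- s].
Definition tens_opp (x : tens) : tens := \pi_tens (tens_opps (repr x)).

Lemma tens_addE s t : tens_add (\pi_tens s) (\pi_tens t) = \pi_tens (s ++ t).
Proof. by apply/tens_piP/TensCat; apply: tens_repr. Qed.

Lemma tens_subrr s : tens_eq (tens_opps s ++ s) [::].
Proof.
elim: s => [|[m n] s IHs]; first exact: TensRefl.
apply: (@TensTrans _ ([:: (- m, n); (m, n)] ++ (tens_opps s ++ s))).
  apply: TensPerm; rewrite /= perm_cons.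
  by rewrite -cat1s perm_catCA.
rewrite -[[::]]cats0; apply: TensCat IHs.
apply: TensTrans (Tens0l n); rewrite -(addNr m).
exact/TensSym/TensDl.
Qed.

Lemma tens_addA : associative tens_add.
Proof.
move=> x y z; rewrite -[x]reprK; move: (repr x) => {x} s.
rewrite -[y]reprK; move: (repr y) => {y} t.
rewrite -[z]reprK; move: (repr z) => {z} u.
by rewrite (tens_addE t u) (tens_addE s (t ++ u)) (tens_addE s t)
  (tens_addE (s ++ t) u) catA.
Qed.

Lemma tens_addC : commutative tens_add.
Proof.
move=> x y; rewrite -[x]reprK; move: (repr x) => {x} s.
rewrite -[y]reprK; move: (repr y) => {y} t.
rewrite (tens_addE s t) (tens_addE t s).
by apply/tens_piP/TensPerm; rewrite perm_catC.
Qed.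

Lemma tens_add0 : left_id (\pi_tens [::]) tens_add.
Proof.
move=> x; rewrite -[x]reprK; move: (repr x) => {x} s.
by rewrite (tens_addE [::] s).
Qed.

Lemma tens_addN : left_inverse (\pi_tens [::]) tens_opp tens_add.
Proof.
move=> x; rewrite -[x]reprK; move: (repr x) => {x} s.
rewrite /tens_opp (tens_addE _ s); apply/tens_piP.
apply: TensTrans (tens_subrr (repr (\pi_tens s))).
by apply: TensCat; [apply: TensRefl|apply/TensSym/tens_repr].
Qed.

HB.instance Definition _ :=
  GRing.isZmodule.Build tens tens_addA tens_addC tens_add0 tens_addN.

Definition tmul (m : M) (n : N) : tens := \pi_tens [:: (m, n)].

Lemma tmulDl m m' n : tmul (m + m') n = tmul m n + tmul m' n.
Proof. by rewrite [RHS]tens_addE; apply/tens_piP/TensDl. Qed.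

Lemma tmulDr m n n' : tmul m (n + n') = tmul m n + tmul m n'.
Proof. by rewrite [RHS]tens_addE; apply/tens_piP/TensDr. Qed.

Lemma tmul_bal m r n : tmul (ra m r) n = tmul m (la r n).
Proof. exact/tens_piP/TensBal. Qed.

Lemma tmul0l n : tmul 0 n = 0.
Proof. by apply: (addrI (tmul 0 n)); rewrite -tmulDl !addr0. Qed.

Lemma tmul0r m : tmul m 0 = 0.
Proof. by apply: (addrI (tmul m 0)); rewrite -tmulDr !addr0. Qed.

Lemma tens_piE s : \pi_tens s = \sum_(p <- s) tmul p.1 p.2.
Proof.
elim: s => [|[m n] s IHs]; first by rewrite big_nil.
by rewrite big_cons -IHs [RHS]tens_addE.
Qed.

Lemma tens_ind (P : tens -> Prop) :
  (forall m n, P (tmul m n)) -> (forall x y, P x -> P y -> P (x + y)) ->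
  forall x, P x.
Proof.
move=> Pm PD x; rewrite -[x]reprK; move: (repr x) => {x} s.
rewrite tens_piE.
elim/big_rec: _ => [|p x _ Px]; first by rewrite -(tmul0l 0).
exact: PD.
Qed.

Section Lift.
Variables (Z : zmodType) (f : M -> N -> Z).

Definition biadditive : Prop :=
  (forall m m' n, f (m + m') n = f m n + f m' n) /\
  (forall m n n', f m (n + n') = f m n + f m n').

Definition balanced : Prop :=
  biadditive /\ forall m r n, f (ra m r) n = f m (la r n).

(* The additive map induced by f when f is balanced. *)
Definition tlift (x : tens) : Z := \sum_(p <- repr x) f p.1 p.2.

Hypothesis fbal : balanced.

Lemma tlift_pi s : tlift (\pi_tens s) = \sum_(p <- s) f p.1 p.2.
Proof.
have [[fDl fDr] fb] := fbal.
suff H t u : tens_eq t u -> \sum_(p <- t) f p.1 p.2 = \sum_(p <- u) f p.1 p.2.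
  exact/H/tens_repr.
elim=> {t u} //=.
- by move=> t u v _ -> _ ->.
- by move=> t t' u u' _ + _ +; rewrite !big_cat /= => -> ->.
- by move=> t u tu; apply: perm_big.
- move=> n; rewrite big_cons !big_nil /= addr0.
  by apply: (addrI (f 0 n)); rewrite -fDl !addr0.
- by move=> m m' n; rewrite !big_cons !big_nil /= !addr0.
- by move=> m n n'; rewrite !big_cons !big_nil /= !addr0.
- by move=> m r n; rewrite !big_cons !big_nil /= !addr0.
Qed.

Lemma tliftE m n : tlift (tmul m n) = f m n.
Proof. by rewrite tlift_pi big_cons big_nil addr0. Qed.

Lemma tliftD x y : tlift (x + y) = tlift x + tlift y.
Proof.
rewrite -[x]reprK; move: (repr x) => {x} s.
rewrite -[y]reprK; move: (repr y) => {y} t.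
by rewrite [_ + _]tens_addE !tlift_pi big_cat.
Qed.

End Lift.

Definition tens_scale (c : T) : tens -> tens :=
  tlift (fun m n => tmul m (c *: n)).

Lemma tens_scale_balanced c : balanced (fun m n => tmul m (c *: n)).
Proof.
split; first split=> [m m' n|m n n'].
- by rewrite tmulDl.
- by rewrite scalerDr tmulDr.
- by move=> m r n; rewrite tmul_bal linearZ.
Qed.

Lemma tens_scaleE c m n : tens_scale c (tmul m n) = tmul m (c *: n).
Proof. exact/tliftE/tens_scale_balanced. Qed.

Lemma tens_scaleD c x y : tens_scale c (x + y) = tens_scale c x + tens_scale c y.
Proof. exact/tliftD/tens_scale_balanced. Qed.

Lemma tens_scalerA a b x : tens_scale a (tens_scale b x) = tens_scale (a * b) x.
Proof.
elim/tens_ind: x => [m n|x y IHx IHy]; first by rewrite !tens_scaleE scalerA.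
by rewrite !tens_scaleD IHx IHy.
Qed.

Lemma tens_scale1r : left_id 1 tens_scale.
Proof.
elim/tens_ind=> [m n|x y IHx IHy]; first by rewrite !tens_scaleE scale1r.
by rewrite !tens_scaleD IHx IHy.
Qed.

Lemma tens_scalerDr : right_distributive tens_scale +%R.
Proof. by move=> c x y; rewrite tens_scaleD. Qed.

Lemma tens_scalerDl x : {morph tens_scale^~ x : a b / a + b}.
Proof.
move=> a b /=; elim/tens_ind: x => [m n|x y IHx IHy].
  by rewrite !tens_scaleE scalerDl tmulDr.
by rewrite !tens_scaleD IHx IHy addrACA.
Qed.

HB.instance Definition _ := GRing.Zmodule_isLmodule.Build T tens
  tens_scalerA tens_scale1r tens_scalerDr tens_scalerDl.

Lemma tmulZ c m n : c *: tmul m n = tmul m (c *: n).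
Proof. exact: tens_scaleE. Qed.

End Tensor.

Lemma tmul_rscale (R : Type) (T : pzRingType) (M : zmodType) (N : rmodType T)
  (ra : M -> R -> M) (la : R -> {linear N -> N}) m n (c : T) :
  tmul ra la m n *> c = tmul ra la m (n *> c).
Proof. exact: tmulZ. Qed.

(* A B-D-bimodule with an epsilon-hermitian form over (D, t), with respect to
   which every b in B has adjoint s b. *)
Record hbimodule (B : pzRingType) (s : involution B)
    (D : pzRingType) (t : involution D) (e : bool) := HBimodule {
  bim_form :> hform t e;
  bim_act : B -> {linear hmod bim_form -> hmod bim_form};
  bim_actD : forall b c v, bim_act (b + c) v = bim_act b v + bim_act c v;
  bim_act1 : forall v, bim_act 1 v = v;
  bim_actM : forall b c v, bim_act (b * c) v = bim_act b (bim_act c v);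
  bim_adj : forall b v w,
    bim_form (bim_act b v) w = bim_form v (bim_act (s b) w)
}.

Section HTensor.
Variables (B : pzRingType) (s : involution B).
Variables (D : pzRingType) (t : involution D) (e : bool).
Variable V : hbimodule s t e.

Section Form.
Variable h : hform s false.

Local Notation ra := (@rscale B (hmod h)).
Local Notation la := (@bim_act _ _ _ _ _ V).
Local Notation "m '(x)' v" := (tmul ra la m v) (at level 40).

Implicit Types x y z : tens ra la.

(* (m (x) v, m' (x) v') |-> V v (h m m' * v') *)
Definition htens_val (x y : tens ra la) : D :=
  tlift (fun m v => tlift (fun m' v' => V v (bim_act V (h m m') v')) y) x.

Lemma htens_bal_r m v :
  balanced ra la (fun m' v' => V v (bim_act V (h m m') v')).
Proof.
split; first split=> [m1 m2 w|m' w w'].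
- by rewrite hformDr bim_actD hformDr.
- by rewrite linearD hformDr.
- by move=> m' b w; rewrite hformZr bim_actM.
Qed.

Lemma htens_bal_l y :
  balanced ra la
    (fun m v => tlift (fun m' v' => V v (bim_act V (h m m') v')) y).
Proof.
split; first split=> [m1 m2 v|m v1 v2]; last move=> m b v.
all: elim/tens_ind: y => [m' v'|x y IHx IHy].
- by rewrite !(tliftE (htens_bal_r _ _)) hformDl bim_actD hformDr.
- by rewrite !(tliftD (htens_bal_r _ _)) IHx IHy addrACA.
- by rewrite !(tliftE (htens_bal_r _ _)) hformDl.
- by rewrite !(tliftD (htens_bal_r _ _)) IHx IHy addrACA.
- by rewrite !(tliftE (htens_bal_r _ _)) hformZl bim_actM bim_adj.
- by rewrite !(tliftD (htens_bal_r _ _)) IHx IHy.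
Qed.

Lemma htens_valE m v m' v' :
  htens_val (m (x) v) (m' (x) v') = V v (bim_act V (h m m') v').
Proof.
by rewrite /htens_val (tliftE (htens_bal_l _)) (tliftE (htens_bal_r _ _)).
Qed.

Lemma htens_valDl x y z : htens_val (x + y) z = htens_val x z + htens_val y z.
Proof. exact: (tliftD (htens_bal_l _)). Qed.

Lemma htens_valDr x y z : htens_val x (y + z) = htens_val x y + htens_val x z.
Proof.
elim/tens_ind: x => [m v|x x' IHx IHx'].
  by rewrite /htens_val !(tliftE (htens_bal_l _)) (tliftD (htens_bal_r _ _)).
by rewrite !htens_valDl IHx IHx' addrACA.
Qed.

Lemma htens_valZ (x y : tens ra la) a b :
  htens_val (x *> a) (y *> b) = t a * htens_val x y * b.
Proof.
elim/tens_ind: x => [m v|x x' IHx IHx']; last first.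
  by rewrite rscaleDl !htens_valDl IHx IHx' mulrDr mulrDl.
elim/tens_ind: y => [m' v'|y y' IHy IHy']; last first.
  by rewrite (rscaleDl y) !htens_valDr IHy IHy' mulrDr mulrDl.
rewrite !tmul_rscale !htens_valE -(hformZ (h := bim_form V)).
by rewrite linear_rscale.
Qed.

Lemma htens_valC x y : htens_val y x = (-1) ^+ e * t (htens_val x y).
Proof.
elim/tens_ind: x => [m v|x x' IHx IHx']; last first.
  by rewrite htens_valDl htens_valDr IHx IHx' invD mulrDr.
elim/tens_ind: y => [m' v'|y y' IHy IHy']; last first.
  by rewrite htens_valDl htens_valDr IHy IHy' invD mulrDr.
rewrite !htens_valE (hformC (h := bim_form V)); congr (_ * t _).
by rewrite bim_adj (hformC m' m) expr0 mul1r.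
Qed.

Lemma htens_dual_basis : dual_basis htens_val.
Proof.
have [I [u [v uv]]] := hform_dual_basis h.
have [J [p [q pq]]] := hform_dual_basis V.
exists (I * J)%type, (fun k => u k.1 (x) p k.2), (fun k => v k.1 (x) q k.2).
have tsuml (K : finType) (F : K -> hmod h) w :
    (\sum_k F k) (x) w = \sum_k (F k (x) w).
  by elim/big_rec2: _ => [|k a b _ <-]; rewrite ?tmul0l ?tmulDl.
have tsumr (K : finType) (F : K -> hmod V) m :
    m (x) (\sum_k F k) = \sum_k (m (x) F k).
  by elim/big_rec2: _ => [|k a b _ <-]; rewrite ?tmul0r ?tmulDr.
elim/tens_ind=> [m w|x y IHx IHy].
  rewrite {1}(uv m) tsuml -(pair_bigA _ (fun i j =>
    (u i (x) p j) *> htens_val (v i (x) q j) (m (x) w))) /=.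
  apply: eq_bigr => i _; rewrite tmul_bal {1}(pq (bim_act V _ w)) tsumr.
  by apply: eq_bigr => j _; rewrite tmul_rscale htens_valE.
rewrite {1}IHx {1}IHy -big_split; apply: eq_bigr => k _.
by rewrite htens_valDr /rscale scalerDl.
Qed.

Definition htens : hform t e :=
  build_hform htens_valDl htens_valDr htens_valZ htens_valC htens_dual_basis.

End Form.

Section Map.
Variables h h' : hform s false.
Local Notation ra := (@rscale B (hmod h)).
Local Notation ra' := (@rscale B (hmod h')).
Local Notation la := (@bim_act _ _ _ _ _ V).

Definition htens_map (f : {linear hmod h -> hmod h'}) :
    tens ra la -> tens ra' la :=
  tlift (fun m v => tmul ra' la (f m) v).

Lemma htens_map_bal (f : {linear hmod h -> hmod h'}) :
  balanced ra la (fun m v => tmul ra' la (f m) v).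
Proof.
split; first split=> [m m' v|m v v'].
- by rewrite linearD tmulDl.
- by rewrite tmulDr.
- by move=> m b v; rewrite linear_rscale tmul_bal.
Qed.

Lemma htens_mapE f m v : htens_map f (tmul ra la m v) = tmul ra' la (f m) v.
Proof. exact/tliftE/htens_map_bal. Qed.

Lemma htens_mapD f x y : htens_map f (x + y) = htens_map f x + htens_map f y.
Proof. exact/tliftD/htens_map_bal. Qed.

Lemma htens_map_linear f : linear (htens_map f).
Proof.
move=> a x y; rewrite htens_mapD; congr (_ + _).
elim/tens_ind: x => [m v|x x' IHx IHx'].
  by rewrite tmulZ !htens_mapE tmulZ.
by rewrite scalerDr !htens_mapD IHx IHx' scalerDr.
Qed.

HB.instance Definition _ f := GRing.isLinear.Build _ _ _ _ (htens_map f)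
  (htens_map_linear f).

End Map.

Section Functor.

Lemma htens_map_bij (h h' : hform s false) (f : isometry h h') :
  bijective (htens_map f).
Proof.
have [g fK gK] := iso_bij f.
have g_lin : linear g by apply: can2_linear gK.
pose gl : {linear hmod h' -> hmod h} :=
  HB.pack g (GRing.isLinear.Build B^c (hmod h') (hmod h) _ g g_lin).
exists (htens_map gl); elim/tens_ind=> [m v|x y IHx IHy].
- by rewrite !htens_mapE /= fK.
- by rewrite !htens_mapD IHx IHy.
- by rewrite !htens_mapE /= gK.
- by rewrite !htens_mapD IHx IHy.
Qed.

Lemma htens_map_val (h h' : hform s false) (f : isometry h h') x y :
  htens_val (htens_map f x) (htens_map f y) = htens_val x y.
Proof.
elim/tens_ind: x => [m v|x x' IHx IHx']; last first.
  by rewrite htens_mapD !htens_valDl IHx IHx'.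
elim/tens_ind: y => [m' v'|y y' IHy IHy']; last first.
  by rewrite (htens_mapD _ y) !htens_valDr IHy IHy'.
by rewrite !htens_mapE !htens_valE iso_val.
Qed.

Definition htens_mor (h h' : hform s false) (f : isometry h h') :
    isometry (htens h) (htens h') :=
  @Isometry D t e (htens h) (htens h') (htens_map f)
    (htens_map_bij f) (htens_map_val f).

Lemma htens_mor_id (h : hform s false) :
  htens_mor (iso_id h) = iso_id (htens h).
Proof.
apply: isometry_eq => x /=; elim/tens_ind: x => [m v|x y IHx IHy].
  by rewrite htens_mapE.
by rewrite htens_mapD IHx IHy.
Qed.

Lemma htens_mor_comp (h1 h2 h3 : hform s false)
    (g : isometry h2 h3) (f : isometry h1 h2) :
  htens_mor (iso_comp g f) = iso_comp (htens_mor g) (htens_mor f).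
Proof.
apply: isometry_eq => x /=; elim/tens_ind: x => [m v|x y IHx IHy].
  by rewrite !htens_mapE.
by rewrite !htens_mapD IHx IHy.
Qed.

Definition htens_functor : hfunctor s false t e :=
  HFunctor htens_mor_id htens_mor_comp.

End Functor.
End HTensor.

(* V is a generator over D (it is finitely generated projective as the module
   of a form) and B is its endomorphism ring. *)
Definition morita_bimodule (B : pzRingType) (s : involution B)
    (D : pzRingType) (t : involution D) (e : bool)
    (V : hbimodule s t e) : Prop :=
  (exists n (f : 'I_n -> {linear hmod V -> regr D}) (v : 'I_n -> hmod V),
      \sum_i f i (v i) = 1) /\
  (forall g : {linear hmod V -> hmod V}, exists! b, g =1 bim_act V b).

(* The functor defined by V is (M, h) |-> (M (x)_B V, htens_val). *)
Record morita_equiv (B : pzRingType) (s : involution B)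
    (D : pzRingType) (t : involution D) (e : bool) := MoritaEquiv {
  morita_fun :> hfunctor s false t e;
  morita_is_equiv : is_equivalence morita_fun;
  morita_given : exists V : hbimodule s t e,
    morita_bimodule V /\ nat_iso morita_fun (htens_functor V)
}.

Definition simple_ring (A : pzRingType) : Prop :=
  (1 : A) <> 0 /\
  forall I : A -> Prop, I 0 -> (forall x y, I x -> I y -> I (x + y)) ->
    (forall a x b, I x -> I (a * x * b)) ->
    (forall x, I x -> x = 0) \/ (forall x, I x).

Section AlgebraInvolution.
Variables (F : fieldType) (A : falgType F).

Definition central : Prop := ('Z({:A}) = 1)%VS.

(* The centre of A is the quadratic extension F(sqrt d), with z = sqrt d, and
   s acts nontrivially on it. *)
Definition unitary_disc (s : involution A) (d : F) : Prop :=
  [/\ forall c, c ^+ 2 != d,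
      exists z : A, z ^+ 2 = d%:A /\ ('Z({:A}) = 1 + <[z]>)%VS
    & exists2 c, c \in ('Z({:A}))%VS & s c != c].

Record alg_involution := AlgInvolution {
  alg_inv :> involution A;
  alg_invZ : forall (c : F) x, alg_inv (c *: x) = c *: alg_inv x;
  alg_simple : simple_ring A;
  alg_center : central \/ exists d, unitary_disc alg_inv d
}.

Definition unitary (s : alg_involution) : Prop := exists d, unitary_disc s d.

Definition orthogonal (s : alg_involution) : Prop :=
  central /\ exists m : nat, (\dim {:A} = m ^ 2)%N /\
    (\dim (fixedSpace (linfun s)) = (m * (m + 1)) %/ 2)%N.

Definition symplectic (s : alg_involution) : Prop :=
  central /\ exists m : nat, (\dim {:A} = m ^ 2)%N /\
    (\dim (fixedSpace (linfun s)) = (m * (m - 1)) %/ 2)%N.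

End AlgebraInvolution.

Section ScalarExtension.
Variables (F L : fieldType) (iota : {rmorphism F -> L}) (A : falgType F).

Definition scalext_ra (a : A) (c : F) : A := c *: a.
Definition scalext_la (c : F) : {linear L^o -> L^o} := *:%R (iota c).

(* A (x)_F L *)
Definition scalext := tens scalext_ra scalext_la.
HB.instance Definition _ := GRing.Lmodule.on scalext.

Definition smul (a : A) (l : L^o) : scalext := tmul scalext_ra scalext_la a l.

Definition scalext_one : scalext := smul 1 1.
Definition scalext_mul (x y : scalext) : scalext :=
  tlift (fun (a : A) (l : L^o) => tlift (fun (a' : A) (l' : L^o) => smul (a * a') (l * l')) y) x.

Implicit Types x y z : tens scalext_ra scalext_la.

Lemma scalext_bal_r a l :
  balanced scalext_ra scalext_la (fun (a' : A) (l' : L^o) => smul (a * a') (l * l')).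
Proof.
split; first split=> [b b' k|b k k'].
- by rewrite mulrDr /smul tmulDl.
- by rewrite mulrDr /smul tmulDr.
- move=> b c k; rewrite /scalext_ra -scalerAr [LHS]tmul_bal; congr tmul.
  by rewrite /= /GRing.scale /= mulrCA.
Qed.

Lemma scalext_bal_l y :
  balanced scalext_ra scalext_la
    (fun (a : A) (l : L^o) => tlift (fun (a' : A) (l' : L^o) => smul (a * a') (l * l')) y).
Proof.
split; first split=> [a1 a2 l|a l1 l2]; last move=> a c l.
all: elim/tens_ind: y => [a' l'|x y IHx IHy].
- by rewrite !(tliftE (scalext_bal_r _ _)) mulrDl [LHS]tmulDl.
- by rewrite !(tliftD (scalext_bal_r _ _)) IHx IHy addrACA.
- by rewrite !(tliftE (scalext_bal_r _ _)) mulrDl [LHS]tmulDr.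
- by rewrite !(tliftD (scalext_bal_r _ _)) IHx IHy addrACA.
- rewrite !(tliftE (scalext_bal_r _ _)) /scalext_ra -scalerAl [LHS]tmul_bal.
  by congr tmul; rewrite /= /GRing.scale /= mulrA.
- by rewrite !(tliftD (scalext_bal_r _ _)) IHx IHy.
Qed.

Lemma scalext_mulE a l a' l' :
  scalext_mul (smul a l) (smul a' l') = smul (a * a') (l * l').
Proof.
by rewrite /scalext_mul (tliftE (scalext_bal_l _)) (tliftE (scalext_bal_r _ _)).
Qed.

Lemma scalext_mulDl : left_distributive scalext_mul +%R.
Proof. by move=> x y z; apply: (tliftD (scalext_bal_l _)). Qed.

Lemma scalext_mulDr : right_distributive scalext_mul +%R.
Proof.
move=> x y z; elim/tens_ind: x => [a l|x x' IHx IHx'].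
  by rewrite /scalext_mul !(tliftE (scalext_bal_l _)) (tliftD (scalext_bal_r _ _)).
by rewrite !scalext_mulDl IHx IHx' addrACA.
Qed.

Lemma scalext_mulA : associative scalext_mul.
Proof.
move=> x y z; elim/tens_ind: x => [a l|x x' IHx IHx']; last first.
  by rewrite !scalext_mulDl IHx IHx'.
elim/tens_ind: y => [b k|y y' IHy IHy']; last first.
  by rewrite scalext_mulDl !scalext_mulDr scalext_mulDl IHy IHy'.
elim/tens_ind: z => [c m|z z' IHz IHz']; last first.
  by rewrite !scalext_mulDr IHz IHz'.
by rewrite -!/(smul _ _) !scalext_mulE !mulrA.
Qed.

Lemma scalext_mul1l : left_id scalext_one scalext_mul.
Proof.
elim/tens_ind=> [a l|x x' IHx IHx']; last by rewrite scalext_mulDr IHx IHx'.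
by rewrite -!/(smul _ _) scalext_mulE !mul1r.
Qed.

Lemma scalext_mul1r : right_id scalext_one scalext_mul.
Proof.
elim/tens_ind=> [a l|x x' IHx IHx']; last by rewrite scalext_mulDl IHx IHx'.
by rewrite -!/(smul _ _) scalext_mulE !mulr1.
Qed.

HB.instance Definition _ := GRing.Zmodule_isPzRing.Build scalext
  scalext_mulA scalext_mul1l scalext_mul1r scalext_mulDl scalext_mulDr.

Lemma smulM a l a' l' : smul a l * smul a' l' = smul (a * a') (l * l').
Proof. exact: scalext_mulE. Qed.

Definition scalext_in (a : A) : scalext := smul a 1.

Variable s : alg_involution A.

(* s (x) id *)
Definition scalext_inv_fun : scalext -> scalext :=
  tlift (fun (a : A) (l : L^o) => smul (s a) l).

Lemma scalext_inv_bal :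
  balanced scalext_ra scalext_la (fun (a : A) (l : L^o) => smul (s a) l).
Proof.
split; first split=> [a b l|a l k].
- by rewrite invD [LHS]tmulDl.
- by rewrite [LHS]tmulDr.
- by move=> a c l; rewrite /scalext_ra alg_invZ [LHS]tmul_bal.
Qed.

Lemma scalext_invE a l : scalext_inv_fun (smul a l) = smul (s a) l.
Proof. exact/tliftE/scalext_inv_bal. Qed.

Lemma scalext_invD : {morph scalext_inv_fun : x y / x + y}.
Proof. by move=> x y; apply/tliftD/scalext_inv_bal. Qed.

Lemma scalext_invM (x y : scalext) :
  scalext_inv_fun (x * y) = scalext_inv_fun y * scalext_inv_fun x.
Proof.
elim/tens_ind: x => [a l|x x' IHx IHx']; last first.
  by rewrite mulrDl !scalext_invD IHx IHx' mulrDr.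
elim/tens_ind: y => [b k|y y' IHy IHy']; last first.
  by rewrite mulrDr !scalext_invD IHy IHy' mulrDl.
by rewrite -!/(smul _ _) smulM !scalext_invE smulM invM (mulrC l).
Qed.

Lemma scalext_invK : involutive scalext_inv_fun.
Proof.
elim/tens_ind=> [a l|x x' IHx IHx']; last by rewrite !scalext_invD IHx IHx'.
by rewrite -!/(smul _ _) !scalext_invE invK.
Qed.

Definition scalext_inv : involution scalext :=
  Involution scalext_invD scalext_invM scalext_invK.
End ScalarExtension.

Section BaseChange.

Section UnitForm.
Variables (R : pzRingType) (s : involution R).
Implicit Types x y z : regr R.

Definition unit_form_val x y : R := s x * y.

Lemma unit_formDl x y z :
  unit_form_val (x + y) z = unit_form_val x z + unit_form_val y z.
Proof. by rewrite /unit_form_val invD mulrDl. Qed.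

Lemma unit_formDr x y z :
  unit_form_val x (y + z) = unit_form_val x y + unit_form_val x z.
Proof. by rewrite /unit_form_val mulrDr. Qed.

Lemma unit_formZ x y a b :
  unit_form_val (x *> a) (y *> b) = s a * unit_form_val x y * b.
Proof. by rewrite /unit_form_val [s _]invM !mulrA. Qed.

Lemma unit_formC x y :
  unit_form_val y x = (-1) ^+ false * s (unit_form_val x y).
Proof. by rewrite expr0 mul1r /unit_form_val invM invK. Qed.

Lemma unit_form_dual_basis : @dual_basis R (regr R) unit_form_val.
Proof.
exists unit, (fun=> 1), (fun=> 1) => m.
rewrite (bigD1 tt) //= big1 ?addr0; last by case.
by rewrite /unit_form_val inv1 mul1r; apply/esym/(@mulr1 R^c).
Qed.

(* The rank one form <1> on the regular right module. *)
Definition unit_form : hform s false :=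
  build_hform unit_formDl unit_formDr unit_formZ unit_formC
    unit_form_dual_basis.

End UnitForm.

Variables (F L : fieldType) (iota : {rmorphism F -> L}).
Variables (A : falgType F) (s : alg_involution A).

Local Notation AL := (scalext iota A).
Local Notation sL := (scalext_inv iota s).
Local Notation jA := (@scalext_in F L iota A).

Definition bc_act (a : A) (x : regr AL) : regr AL := (jA a : AL) * (x : AL).

Lemma bc_act_linear a : linear (bc_act a).
Proof.
move=> c x y; rewrite /bc_act [LHS]mulrDr; congr (_ + _).
exact: (mulrA (jA a : AL) x c).
Qed.
HB.instance Definition _ a :=
  GRing.isLinear.Build _ (regr AL) (regr AL) _ (bc_act a) (bc_act_linear a).

Lemma scalext_inD a b : jA (a + b) = jA a + jA b.
Proof. exact: tmulDl. Qed.

Lemma scalext_inM a b : jA (a * b) = jA a * jA b.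
Proof. by rewrite /scalext_in smulM mulr1. Qed.

Lemma bc_actD a b x : bc_act (a + b) x = bc_act a x + bc_act b x.
Proof. by rewrite /bc_act scalext_inD mulrDl. Qed.

Lemma bc_act1 x : bc_act 1 x = x.
Proof. exact: (mul1r (x : AL)). Qed.

Lemma bc_actM a b x : bc_act (a * b) x = bc_act a (bc_act b x).
Proof. by rewrite /bc_act scalext_inM mulrA. Qed.

Lemma bc_adj a x y :
  unit_form sL (bc_act a x) y = unit_form sL x (bc_act (s a) y).
Proof.
have E : sL (jA a) = jA (s a) := scalext_invE iota s a 1.
by rewrite /= /unit_form_val /bc_act invM E mulrA.
Qed.

(* A (x)_F L as an A-(A (x)_F L)-bimodule. *)
Definition bc_bimodule : hbimodule s sL false :=
  @HBimodule A s AL sL false (unit_form sL)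
    (fun a => bc_act a : {linear _ -> _}) bc_actD bc_act1 bc_actM bc_adj.

(* h (x) L, on the module M (x)_A (A (x)_F L). *)
Definition base_change (h : hform s false) : hform sL false :=
  htens bc_bimodule h.

End BaseChange.

(* Hamilton quaternions (-1, -1)_K, with basis 1, i, j, k. *)
Record quat (K : Type) := Quat { qr : K; qi : K; qj : K; qk : K }.

Section Quaternions.
Variable K : comNzRingType.

Definition quat_to (x : quat K) := (qr x, qi x, qj x, qk x).
Definition quat_of (x : K * K * K * K) := Quat x.1.1.1 x.1.1.2 x.1.2 x.2.
Lemma quat_toK : cancel quat_to quat_of. Proof. by case. Qed.
HB.instance Definition _ := Choice.copy (quat K) (can_type quat_toK).

Implicit Types x y z : quat K.

Lemma quat_eq x y :
  qr x = qr y -> qi x = qi y -> qj x = qj y -> qk x = qk y -> x = y.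
Proof. by case: x y => ? ? ? ? [? ? ? ?] /= -> -> -> ->. Qed.

Definition quat_add x y :=
  Quat (qr x + qr y) (qi x + qi y) (qj x + qj y) (qk x + qk y).
Definition quat_opp x := Quat (- qr x) (- qi x) (- qj x) (- qk x).
Definition quat_mul x y :=
  Quat (qr x * qr y - qi x * qi y - qj x * qj y - qk x * qk y)
       (qr x * qi y + qi x * qr y + qj x * qk y - qk x * qj y)
       (qr x * qj y - qi x * qk y + qj x * qr y + qk x * qi y)
       (qr x * qk y + qi x * qj y - qj x * qi y + qk x * qr y).
Definition quat_conj x := Quat (qr x) (- qi x) (- qj x) (- qk x).

Lemma quat_addA : associative quat_add.
Proof. by move=> x y z; apply: quat_eq; rewrite /= addrA. Qed.
Lemma quat_addC : commutative quat_add.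
Proof. by move=> x y; apply: quat_eq; rewrite /= addrC. Qed.
Lemma quat_add0 : left_id (Quat 0 0 0 0) quat_add.
Proof. by move=> x; apply: quat_eq; rewrite /= add0r. Qed.
Lemma quat_addN : left_inverse (Quat 0 0 0 0) quat_opp quat_add.
Proof. by move=> x; apply: quat_eq; rewrite /= addNr. Qed.
HB.instance Definition _ := GRing.isZmodule.Build (quat K)
  quat_addA quat_addC quat_add0 quat_addN.

Lemma quat_mulA : associative quat_mul.
Proof. by move=> x y z; apply: quat_eq => /=; ring. Qed.
Lemma quat_mul1l : left_id (Quat 1 0 0 0) quat_mul.
Proof. by move=> x; apply: quat_eq => /=; ring. Qed.
Lemma quat_mul1r : right_id (Quat 1 0 0 0) quat_mul.
Proof. by move=> x; apply: quat_eq => /=; ring. Qed.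
Lemma quat_mulDl : left_distributive quat_mul +%R.
Proof. by move=> x y z; apply: quat_eq => /=; ring. Qed.
Lemma quat_mulDr : right_distributive quat_mul +%R.
Proof. by move=> x y z; apply: quat_eq => /=; ring. Qed.
HB.instance Definition _ := GRing.Zmodule_isPzRing.Build (quat K)
  quat_mulA quat_mul1l quat_mul1r quat_mulDl quat_mulDr.

Lemma quat_conjD : {morph quat_conj : x y / x + y}.
Proof. by move=> x y; apply: quat_eq => /=; ring. Qed.
Lemma quat_conjM x y : quat_conj (x * y) = quat_conj y * quat_conj x.
Proof. by apply: quat_eq => /=; ring. Qed.
Lemma quat_conjK : involutive quat_conj.
Proof. by move=> x; apply: quat_eq => /=; ring. Qed.

Definition quat_inv : involution (quat K) :=
  Involution quat_conjD quat_conjM quat_conjK.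

End Quaternions.

Section StandardInvolutions.

Definition id_inv (K : comPzRingType) : involution K :=
  @Involution K id (fun _ _ => erefl) (fun x y => mulrC x y) (fun _ => erefl).

Definition conjc_inv (L : rcfType) : involution L[i] :=
  @Involution L[i] (@conjc L) (rmorphD (@conjc L))
    (fun x y => etrans (congr1 (@conjc L) (mulrC x y)) (rmorphM (@conjc L) y x))
    (@conjcK L).

Definition swap (K : Type) (x : K * K) : K * K := (x.2, x.1).

Definition swap_inv (K : comPzRingType) : involution (K * K)%type :=
  @Involution (K * K)%type (@swap K) (fun _ _ => erefl)
    (fun x y => f_equal2 pair (mulrC x.2 y.2) (mulrC x.1 y.1))
    (fun x => match x with (_, _) => erefl end).

End StandardInvolutions.

(* The four possibilities L, L(sqrt(-1)), (-1,-1)_L and L x L for D_P. *)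
Variant dkind := DReal | DComplex | DQuat | DSplit.

Definition Dring (k : dkind) (L : rcfType) : pzRingType :=
  match k with
  | DReal => L
  | DComplex => L[i]
  | DQuat => quat L
  | DSplit => (L * L)%type
  end.

Definition Dinv (k : dkind) (L : rcfType) : involution (Dring k L) :=
  match k with
  | DReal => id_inv L
  | DComplex => conjc_inv L
  | DQuat => quat_inv L
  | DSplit => swap_inv L
  end.

(* h is isometric to the diagonal form <alpha_1, ..., alpha_n>. *)
Definition diagonalization (D : pzRingType) (t : involution D) (e : bool)
    (h : hform t e) (n : nat) (alpha : 'I_n -> int) : Prop :=
  exists phi : {linear hmod h -> 'rV[D^c]_n}, bijective phi /\
    forall x y, h x y =
      \sum_i t (phi x 0 i : D) * (alpha i)%:~R * (phi y 0 i : D).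

(* Sylvester's law of inertia makes the sum independent of the chosen
   diagonalization. *)
Definition diag_sign (D : pzRingType) (t : involution D) (e : bool)
    (h : hform t e) : int :=
  xget 0 [set z : int | exists n (alpha : 'I_n -> int),
    [/\ forall i, alpha i = 1 \/ alpha i = -1,
        diagonalization h alpha & z = \sum_i alpha i]].

Definition sign (k : dkind) (L : rcfType) (e : bool)
    (h : hform (Dinv k L) e) : int :=
  match k, e with
  | DSplit, _ | _, true => 0
  | _, false => diag_sign h
  end.

Definition formally_real (F : fieldType) : Prop :=
  forall r : seq F, \sum_(x <- r) x ^+ 2 <> -1.

Record ordering (F : fieldType) := Ordering {
  ord_pos :> F -> Prop;
  ord_add : forall x y, ord_pos x -> ord_pos y -> ord_pos (x + y);
  ord_mul : forall x y, ord_pos x -> ord_pos y -> ord_pos (x * y);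
  ord_total : forall x, ord_pos x \/ ord_pos (- x);
  ord_anti : forall x, ord_pos x -> ord_pos (- x) -> x = 0
}.

Definition real_closure (F : fieldType) (P : ordering F) (L : rcfType)
    (iota : {rmorphism F -> L}) : Prop :=
  (forall x, P x -> exists y, iota x = y ^+ 2) /\
  (forall u : L, algebraicOver iota u).

Section Signature.
Variables (F : fieldType) (A : falgType F) (s : alg_involution A).
Variable P : ordering F.

Section RealClosure.
Variables (L : rcfType) (iota : {rmorphism F -> L}).

Local Notation AL := (scalext iota A).

Definition split_over : Prop :=
  exists n (phi : {rmorphism AL -> 'M[L]_n}), bijective phi /\ scalable phi.

(* The kind of D_P. When A is central and A (x)_F L is not a matrix algebra
   over L, it is a matrix algebra over (-1,-1)_L. *)
Definition DP_kind : dkind :=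
  if `[< exists2 d, unitary_disc s d & P (- d) >] then DComplex
  else if `[< exists2 d, unitary_disc s d & P d >] then DSplit
  else if `[< split_over >] then DReal
  else DQuat.

Definition DP : pzRingType := Dring DP_kind L.
Definition thetaP : involution DP := Dinv DP_kind L.

(* epsilon_P = (-1) ^+ epsP; the identity of L is orthogonal and quaternion
   conjugation is symplectic. *)
Definition epsP : bool :=
  match DP_kind with
  | DReal => `[< symplectic s >]
  | DQuat => `[< orthogonal s >]
  | DComplex | DSplit => false
  end.

Definition morita_at : Type := morita_equiv (scalext_inv iota s) thetaP epsP.

Definition sign_form (M : morita_at) (h : hform s false) : int :=
  sign (M (base_change iota h)).

(* The signature of a Witt class is the signature of a form representing
   it. *)
Definition sign_witt (M : morita_at) (w : witt s false) : int :=
  xget 0 [set z : int | exists2 h, w h & z = sign_form M h].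

End RealClosure.

(* D_P does not depend on the real closure of F at P. *)
Definition nil_ordering : Prop :=
  exists (L : rcfType) (iota : {rmorphism F -> L}), real_closure P iota /\
    [\/ orthogonal s /\ DP_kind iota = DQuat,
        symplectic s /\ DP_kind iota = DReal |
        unitary s /\ DP_kind iota = DSplit].

End Signature.

(* Main.v *)
Require Import Defs.
From HB Require Import structures.
From mathcomp Require Import all_boot all_order all_algebra all_field.
From mathcomp Require Import complex ring lra zify boolp classical_sets.

(* For forms h, h0 on M, M0 consider on M x M0 the F-valued trace form
   q((x, y), (x', y')) = Tr (h x x' * h0 y' y), with Tr a the trace of left
   multiplication by a on A; it stands for the form h (x) h0 on the tensor
   product of M and the conjugate of M0 over A. If V is the bimodule of a
   Morita equivalence over a real closure L, then the pure tensors x (x) y can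
   be rewritten through V, and q becomes over L a positive multiple of
   Re (hU u u' * hU0 u0' u0) for the Morita images hU, hU0 of h, h0. Hence the
   signature of q at P is (dim_L D_P) * sign hU * sign hU0. The left-hand side
   does not depend on L nor on the equivalence, and dim_L D_P does not either,
   as N * (1, 0 or -2) is the trace of the involution of A for some N > 0.
   Taking h = h0 shows that the two signatures of h0 agree up to sign, and then
   the products sign h0 * sign h agree. *)

Set Implicit Arguments.
Unset Strict Implicit.
Unset Printing Implicit Defensive.

Import Order.TTheory GRing.Theory Num.Theory.

Local Open Scope ring_scope.

(** * Signatures of bilinear forms on pairs of points *)

Section Preforms.
Variables (K : fieldType) (X : Type).
Implicit Types (f g : X -> K) (s : seq (K * X)) (q : X -> X -> K).

(** A single signature cannot be compared directly: replacing the form on the bimodule [V] by its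
    negative gives another Morita equivalence and flips the sign of every signature. In [pair_form]
    the form on [V] enters twice, so this ambiguity cancels. The tensor product carrying h (x) h0 is
    never built: its pure tensors are kept as a bare type of points, and formal linear combinations
    of points, compared through the form itself, supply the linear algebra. A second obstacle is
    that a Morita equivalence is one of rings only, so a scalar l of L may act as [tau l] for an
    automorphism [tau] of the field L. The trace form is therefore studied along [tau \o iota]
    instead of [iota]. Since [tau] maps squares to squares, this is again an embedding of F that
    makes P nonnegative, and the signs of the images of elements of F depend only on P. *)

Definition lsum f s : K := \sum_(p <- s) p.1 * f p.2.

Lemma lsum_nil f : lsum f [::] = 0.
Proof. exact: big_nil. Qed.

Lemma lsum_cons f p s : lsum f (p :: s) = p.1 * f p.2 + lsum f s.
Proof. exact: big_cons. Qed.

Lemma lsum_cat f s s' : lsum f (s ++ s') = lsum f s + lsum f s'.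
Proof. exact: big_cat. Qed.

Lemma lsum1 f x : lsum f [:: (1, x)] = f x.
Proof. by rewrite lsum_cons lsum_nil mul1r addr0. Qed.

Lemma eq_lsum f g s : f =1 g -> lsum f s = lsum g s.
Proof. by move=> fg; apply: eq_bigr => p _; rewrite fg. Qed.

Lemma lsum_sum (I : finType) (f : I -> X -> K) s :
  lsum (fun x => \sum_i f i x) s = \sum_i lsum (f i) s.
Proof.
rewrite /lsum exchange_big /=; apply: eq_bigr => p _; exact: mulr_sumr.
Qed.

Lemma lsumMr f c s : lsum (fun x => f x * c) s = lsum f s * c.
Proof. by rewrite /lsum mulr_suml; apply: eq_bigr => p _; rewrite mulrA. Qed.

Lemma lsumMl f c s : lsum (fun x => c * f x) s = c * lsum f s.
Proof. by rewrite /lsum mulr_sumr; apply: eq_bigr => p _; rewrite mulrCA. Qed.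

Lemma lsumD f g s : lsum (fun x => f x + g x) s = lsum f s + lsum g s.
Proof. by rewrite /lsum -big_split; apply: eq_bigr => p _; rewrite mulrDr. Qed.

Definition lscale c s : seq (K * X) := [seq (c * p.1, p.2) | p <- s].

Lemma lsum_scale f c s : lsum f (lscale c s) = c * lsum f s.
Proof.
by rewrite /lsum big_map mulr_sumr; apply: eq_bigr => p _; rewrite mulrA.
Qed.

Lemma lsum_flatten (I : Type) (r : seq I) f (s : I -> seq (K * X)) :
  lsum f (flatten [seq s i | i <- r]) = \sum_(i <- r) lsum f (s i).
Proof. by rewrite /lsum big_flatten big_map. Qed.

(* The bilinear extension of q to formal linear combinations of points. *)
Definition blsum q s s' : K := lsum (fun x => lsum (q x) s') s.

Lemma blsumC q s s' : (forall x y, q x y = q y x) -> blsum q s s' = blsum q s' s.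
Proof.
move=> qC; rewrite /blsum /lsum.
under eq_bigr do rewrite mulr_sumr; under [RHS]eq_bigr do rewrite mulr_sumr.
rewrite exchange_big /=; apply: eq_bigr => p _; apply: eq_bigr => r _.
by rewrite mulrCA qC.
Qed.

(* q is the pullback of the diagonal form d along a map C from X to K^J whose
   image spans; E gives, for each vector of the standard basis, a combination
   of points mapped to it. *)
Definition diag_form q (J : finType) (d : J -> K) : Prop :=
  exists (C : X -> J -> K) (E : J -> seq (K * X)),
    [/\ forall j, d j != 0,
        forall x y, q x y = \sum_j C x j * d j * C y j
      & forall i j, lsum (C^~ j) (E i) = (i == j)%:R].

(** Substitute for finite dimension, [X] being a bare type: it bounds the length of orthogonal
    families of nonisotropic points. *)
Definition finite_rank (q : X -> X -> K) (I : finType) : Prop :=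
  exists f g : I -> X -> K, forall x y, q x y = \sum_i f i x * g i y.

Lemma blsum_diag q (J : finType) (C : X -> J -> K) (d : J -> K) s s' :
    (forall x y, q x y = \sum_j C x j * d j * C y j) ->
  blsum q s s' = \sum_j lsum (C^~ j) s * d j * lsum (C^~ j) s'.
Proof.
move=> qE; rewrite /blsum.
under eq_lsum => x.
  under eq_lsum do rewrite qE.
  rewrite lsum_sum; under eq_bigr do rewrite lsumMl.
  over.
by rewrite lsum_sum; apply: eq_bigr => j _; rewrite !lsumMr.
Qed.

Lemma eq_diag_form q q' (J : finType) (d : J -> K) :
  (forall x y, q x y = q' x y) -> diag_form q d -> diag_form q' d.
Proof. by move=> qq' [C [E [d0 qE CE]]]; exists C, E; split=> // x y; rewrite -qq'. Qed.

Lemma diag_formZ q (J : finType) (d : J -> K) c : c != 0 ->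
  diag_form q d -> diag_form (fun x y => c * q x y) (fun j => c * d j).
Proof.
move=> c0 [C [E [d0 qE CE]]]; exists C, E; split=> // [j|x y].
  by rewrite mulf_neq0.
by rewrite qE mulr_sumr; apply: eq_bigr => j _; ring.
Qed.

(** The Gram matrix of the family factors through K^I, and it is invertible because it is diagonal
    with nonzero entries. *)
Lemma orthogonal_family_bound q (I : finType) n (e : 'I_n -> X) :
    finite_rank q I -> (forall i j, i != j -> q (e i) (e j) = 0) ->
    (forall i, q (e i) (e i) != 0) -> (n <= #|I|)%N.
Proof.
move=> [f [g qE]] qe0 qe1.
pose a := \matrix_(i < n, k < #|I|) f (enum_val k) (e i).
pose b := \matrix_(k < #|I|, j < n) g (enum_val k) (e j).
have abE : a *m b = diag_mx (\row_i q (e i) (e i)).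
  apply/matrixP=> i j; rewrite !mxE.
  under eq_bigr do rewrite !mxE.
  have -> : \sum_(k < #|I|) f (enum_val k) (e i) * g (enum_val k) (e j) =
            q (e i) (e j).
    rewrite qE [RHS](reindex (fun k : 'I_#|I| => enum_val k)) //=.
    by apply: onW_bij; exists enum_rank; [apply: enum_valK|apply: enum_rankK].
  have [->|ij] := eqVneq i j; first by rewrite mulr1n.
  by rewrite mulr0n qe0.
have ab_unit : a *m b \in unitmx.
  rewrite abE unitmxE det_diag unitfE; apply/prodf_neq0 => i _.
  by rewrite !mxE qe1.
have := mxrankM_maxl a b; rewrite (mxrank_unit ab_unit) => /leq_trans; apply.
exact: rank_leq_col.
Qed.

Lemma finite_rank_blsum q (I : finType) : finite_rank q I ->
  exists f g : I -> seq (K * X) -> K,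
    forall s s', blsum q s s' = \sum_i f i s * g i s'.
Proof.
move=> [f [g qE]]; exists (fun i => lsum (f i)), (fun i => lsum (g i)) => s s'.
rewrite /blsum; under eq_lsum => x.
  under eq_lsum do rewrite qE.
  rewrite lsum_sum; under eq_bigr do rewrite lsumMl.
  over.
by rewrite lsum_sum; apply: eq_bigr => i _; rewrite lsumMr.
Qed.

End Preforms.

(* A maximal orthogonal family of nonisotropic combinations diagonalizes q. *)
Lemma diag_form_exists (K : fieldType) (X : Type) (q : X -> X -> K)
    (I : finType) :
    (2%:R : K) != 0 -> (forall x y, q x y = q y x) -> finite_rank q I ->
  exists n (d : 'I_n -> K), diag_form q d.
Proof.
move=> two0 qC qfr.
pose orth n := exists e : 'I_n -> seq (K * X),
  (forall i j, i != j -> blsum q (e i) (e j) = 0) /\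
  (forall i, blsum q (e i) (e i) != 0).
have orth0 : exists n, `[< orth n >].
  by exists 0%N; apply/asboolP; exists (fun=> [::]); split=> -[].
have orth_bound n : `[< orth n >] -> (n <= #|I|)%N.
  move=> /asboolP[e [e0 e1]].
  exact: orthogonal_family_bound (finite_rank_blsum qfr) e0 e1.
case: (ex_maxnP orth0 orth_bound) => n /asboolP[e [e0 e1]] n_max.
pose d i := blsum q (e i) (e i).
pose C x i := lsum (q x) (e i) / d i.
have lC s i : lsum (C^~ i) s = blsum q s (e i) / d i by rewrite lsumMr.
exists n, d, C, e; split=> //; last first.
  move=> i j; rewrite lC; have [->|ij] := eqVneq i j; first by rewrite divff.
  by rewrite e0 // mul0r.
(* [q'] is what remains of [q] on the orthogonal complement of [e]; the point is that it
   vanishes. *)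
pose q' x y := q x y - \sum_j C x j * d j * C y j.
suff q'0 : forall x y, q' x y = 0.
  by move=> x y; apply/eqP; rewrite -subr_eq0 -/(q' x y) q'0.
have q'C u v : q' u v = q' v u.
  by rewrite /q' qC; congr (_ - _); apply: eq_bigr => j _; ring.
pose proj s := s ++ flatten [seq lscale (- lsum (C^~ j) s) (e j) | j : 'I_n].
have lproj f s : lsum f (proj s) = lsum f s - \sum_j lsum (C^~ j) s * lsum f (e j).
  rewrite lsum_cat lsum_flatten big_enum -sumrN; congr (_ + _).
  by apply: eq_bigr => j _; rewrite lsum_scale mulNr.
have bproj s s' : blsum q (proj s) s' = blsum q' s s'.
  rewrite /blsum lproj /q'.
  under [RHS]eq_lsum => z.
    under eq_lsum => w.
      rewrite -mulN1r; over.
    rewrite lsumD lsumMl lsum_sum.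
    under eq_bigr do rewrite lsumMl.
    over.
  rewrite lsumD lsumMl mulN1r lsum_sum; congr (_ - _); apply: eq_bigr => j _.
  rewrite lsumMr lsumMr -mulrA; congr (_ * _).
  rewrite [lsum _ (e j)](_ : _ = blsum q (e j) s') // blsumC //.
  by rewrite lC mulrC divfK ?e1.
have proj_orth s j : blsum q (proj s) (e j) = 0.
  rewrite {1}/blsum lproj; apply/eqP; rewrite subr_eq0; apply/eqP.
  rewrite (bigD1 j) //= big1 ?addr0 => [|k kj].
    by rewrite lC divfK ?e1.
  by rewrite [X in _ * X](e0 k j kj) mulr0.
(* Otherwise the projection of [s] could be added to [e], against maximality. *)
have q'iso s : blsum q' s s = 0.
  apply/eqP; apply: contrapT => /negP q's.
  suff /asboolP/n_max : orth n.+1 by rewrite ltnn.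
  pose f (i : 'I_n.+1) := oapp e (proj s) (unlift ord0 i).
  have pss : blsum q (proj s) (proj s) = blsum q' s s.
    rewrite -bproj [RHS]blsumC // [LHS]/blsum lproj.
    rewrite -[X in X - _]/(blsum q s (proj s)) big1 ?subr0 // => j _.
    by rewrite -[X in _ * X]/(blsum q (e j) (proj s)) blsumC // proj_orth mulr0.
  exists f; split=> [i j|i].
    rewrite /f; case: unliftP => [i' ->|->]; case: unliftP => [j' ->|->] //=.
    - by rewrite (inj_eq lift_inj); apply: e0.
    - by rewrite blsumC // proj_orth.
  by rewrite /f; case: unliftP => [i' _|_] //=; rewrite pss.
have q'11 x y : blsum q' [:: (1, x)] [:: (1, y)] = q' x y.
  by rewrite /blsum !lsum1.
(* Polarization: the value at x + y gives [2 * q' x y = 0]. *)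
move=> x y; have := q'iso [:: (1, x); (1, y)]; rewrite /blsum !lsum_cons !lsum_nil /=.
rewrite !mul1r !addr0 -!q'11 !q'iso [blsum q' _ [:: (1, x)]]blsumC //.
rewrite add0r addr0 -mulr2n -mulr_natl => /eqP.
by rewrite mulf_eq0 (negPf two0) => /eqP.
Qed.

Section Transport.
Variables (K : fieldType) (X X' : Type) (q : X -> X -> K) (q' : X' -> X' -> K).
Variable J : X' -> seq (K * X).
Hypothesis q'E : forall x y, q' x y = blsum q (J x) (J y).
Hypothesis J_span : forall u, exists s : seq (K * X'), forall w,
  q u w = lsum (fun x => lsum (q^~ w) (J x)) s.

(** [J_span] says that the combinations [J x] span modulo the radical of [q]. The coordinates [C]
    vanish on the radical, because pairing u with [E j] gives [C u j * d j]; so each [E j] can be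
    rewritten by points of [X'] without changing its coordinates. *)
Lemma diag_form_transport (I : finType) (d : I -> K) :
  diag_form q d -> diag_form q' d.
Proof.
move=> [C [E [d0 qE CE]]].
have qEr u j : lsum (q u) (E j) = C u j * d j.
  under eq_lsum do rewrite qE.
  rewrite lsum_sum (bigD1 j) //= big1 ?addr0 => [|i ij].
    by rewrite lsumMl CE eqxx mulr1.
  by rewrite lsumMl CE eq_sym (negPf ij) mulr0.
have [t tE] := choice J_span.
have tC u j : lsum (fun x => lsum (C^~ j) (J x)) (t u) = C u j.
  apply: (mulIf (d0 j)); rewrite -qEr.
  under [RHS]eq_lsum do rewrite tE.
  rewrite -lsumMr.
  transitivity (lsum (fun x => lsum (fun u' => lsum (q u') (E j)) (J x)) (t u)).
    apply: eq_lsum => x; rewrite -lsumMr; apply: eq_lsum => u'.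
    by rewrite qEr.
  rewrite /lsum; under eq_bigr => p _.
    under eq_bigr => p' _ do rewrite mulr_sumr.
    rewrite exchange_big /= mulr_sumr; over.
  rewrite exchange_big; apply: eq_bigr => r _; rewrite mulr_sumr.
  apply: eq_bigr => p _; rewrite mulrCA; congr (_ * _).
  by rewrite mulr_sumr; apply: eq_bigr => p' _; rewrite mulrCA.
exists (fun x j => lsum (C^~ j) (J x)).
exists (fun i => flatten [seq lscale p.1 (t p.2) | p <- E i]); split=> // [x y|i j].
  by rewrite q'E (blsum_diag _ _ qE).
rewrite lsum_flatten; under eq_bigr do rewrite lsum_scale tC.
exact: CE.
Qed.

End Transport.

Lemma diag_form_map (K L : fieldType) (k : {rmorphism K -> L}) (X : Type)
    (q : X -> X -> K) (J : finType) (d : J -> K) :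
  diag_form q d -> diag_form (fun x y => k (q x y)) (fun j => k (d j)).
Proof.
move=> [C [E [d0 qE CE]]].
exists (fun x j => k (C x j)), (fun i => [seq (k p.1, p.2) | p <- E i]).
split=> [j|x y|i j]; first by rewrite fmorph_eq0.
  by rewrite qE rmorph_sum; apply: eq_bigr => j _; rewrite !rmorphM.
rewrite -(rmorph_nat k) -CE /lsum big_map rmorph_sum.
by apply: eq_bigr => p _; rewrite rmorphM.
Qed.

(** * Sylvester's law of inertia and signatures over an ordered field *)

Section Inertia.
Variable R : realFieldType.

(** The rows of [c] are vectors, in coordinates diagonalizing by [d'], whose Gram matrix is diagonal
    with entries [d]. With more positive [d] than positive [d'], some nontrivial combination of the
    rows with positive [d] has zero coordinates wherever [d'] is positive; its value would be both
    positive and at most 0. *)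
Lemma pos_index_le (J J' : finType) (d : J -> R) (d' : J' -> R)
    (c : J -> J' -> R) :
    (forall i k, \sum_j c i j * d' j * c k j = d i *+ (i == k)) ->
  (#|[pred i | 0 < d i]%R| <= #|[pred j | 0 < d' j]%R|)%N.
Proof.
move=> cE; rewrite leqNgt; apply/negP => lt_pos.
set n := #|_| in lt_pos; set m := #|_| in lt_pos.
pose B := \matrix_(i < m, j < n) c (enum_val i) (enum_val j).
have /rowV0Pn[a /sub_kermxP aB a0] : kermx B != 0.
  rewrite kermx_eq0 /row_free neq_ltn.
  by rewrite (leq_ltn_trans (rank_leq_col B) lt_pos).
pose e j := \sum_(k < m) a 0 k * c (enum_val k) j.
have e0 j : 0 < d' j -> e j = 0.
  move=> dj; have := congr1 (fun M : 'rV_n => M 0 (enum_rank_in dj j)) aB.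
  rewrite !mxE => eq0; rewrite -[RHS]eq0; apply: eq_bigr => k _.
  by rewrite mxE enum_rankK_in.
have : \sum_(j : J') e j * d' j * e j = \sum_(k < m) a 0 k * d (enum_val k) * a 0 k.
  transitivity (\sum_(j : J') \sum_(k < m) \sum_(l < m)
      a 0 k * a 0 l * (c (enum_val k) j * d' j * c (enum_val l) j)).
    apply: eq_bigr => j _; rewrite /e mulr_suml mulr_suml; apply: eq_bigr => k _.
    by rewrite mulr_sumr; apply: eq_bigr => l _; ring.
  rewrite exchange_big; apply: eq_bigr => k _; rewrite exchange_big /=.
  rewrite (bigD1 k) //= -mulr_sumr cE eqxx mulr1n big1 ?addr0 => [|l lk].
    by ring.
  by rewrite -mulr_sumr cE (inj_eq enum_val_inj) eq_sym (negPf lk) mulr0.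
move/eqP; rewrite lt_eqF //; apply: (@le_lt_trans _ _ 0).
  apply: sumr_le0 => j _; have [/e0 ->|d'j] := ltrP 0 (d' j).
    by rewrite mulr0.
  by rewrite mulrAC -expr2 mulr_ge0_le0 ?sqr_ge0.
have [k ak] : exists k, a 0 k != 0.
  apply/existsP; apply: contra_neqT a0 => /existsPn a0.
  by apply/rowP=> k; rewrite mxE; apply/eqP; have := a0 k; rewrite negbK.
have dpos (l : 'I_m) : 0 < d (enum_val l) by have := enum_valP l; rewrite inE.
rewrite (bigD1 k) //= ltr_pwDl //.
  by rewrite mulrAC -expr2 mulr_gt0 // lt0r sqrf_eq0 ak sqr_ge0.
apply: sumr_ge0 => l _; rewrite mulrAC -expr2 mulr_ge0 ?sqr_ge0 //.
exact/ltW.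
Qed.

Lemma sum_sgz (J : finType) (d : J -> R) :
  \sum_j sgz (d j) = #|[pred j | 0 < d j]|%:Z - #|[pred j | 0 < - d j]|%:Z.
Proof.
rewrite -!sum1_card -!natz !natr_sum [X in X - _]big_mkcond.
rewrite [X in _ - X]big_mkcond -sumrB; apply: eq_bigr => j _ /=.
rewrite !inE oppr_gt0; case: sgzP => //; lia.
Qed.

Lemma diag_form_sig_le (X : Type) (q : X -> X -> R) (J J' : finType)
    (d : J -> R) (d' : J' -> R) :
    diag_form q d -> diag_form q d' ->
  (#|[pred i | 0 < d i]%R| <= #|[pred j | 0 < d' j]%R|)%N.
Proof.
move=> [C [E [d0 qE CE]]] [C' [E' [d'0 qE' CE']]].
apply: (@pos_index_le _ _ _ _ (fun i j => lsum (C'^~ j) (E i))) => i k.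
rewrite -(blsum_diag _ _ qE') (blsum_diag _ _ qE) (bigD1 i) //= big1 => [|j ji].
  by rewrite !CE eqxx mul1r addr0 mulr_natr eq_sym.
by rewrite CE eq_sym (negPf ji) !mul0r.
Qed.

(** The negative entries are counted as the positive entries for [-1 * q]. *)
Lemma sylvester_inertia (X : Type) (q : X -> X -> R) (J J' : finType)
    (d : J -> R) (d' : J' -> R) :
  diag_form q d -> diag_form q d' -> \sum_j sgz (d j) = \sum_j sgz (d' j).
Proof.
move=> qd qd'; rewrite !sum_sgz.
have N1 : (-1 : R) != 0 by rewrite oppr_eq0 oner_eq0.
have [mqd mqd'] := (diag_formZ N1 qd, diag_formZ N1 qd').
have negE (I : finType) (f : I -> R) :
    #|[pred j | 0 < - f j]| = #|[pred j | 0 < -1 * f j]|.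
  by apply: eq_card => j; rewrite !inE mulN1r.
congr (_%:Z - _%:Z); apply/eqP; rewrite ?negE.
  by rewrite eqn_leq (diag_form_sig_le qd qd') (diag_form_sig_le qd' qd).
by rewrite eqn_leq (diag_form_sig_le mqd mqd') (diag_form_sig_le mqd' mqd).
Qed.

Definition has_sig (X : Type) (q : X -> X -> R) (z : int) : Prop :=
  exists (J : finType) (d : J -> R), diag_form q d /\ z = \sum_j sgz (d j).

Lemma has_sig_uniq (X : Type) (q : X -> X -> R) z z' :
  has_sig q z -> has_sig q z' -> z = z'.
Proof.
by move=> [J [d [qd ->]]] [J' [d' [qd' ->]]]; apply: sylvester_inertia qd qd'.
Qed.

Lemma has_sigZ (X : Type) (q : X -> X -> R) z c : 0 < c ->
  has_sig q z -> has_sig (fun x y => c * q x y) z.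
Proof.
move=> c0 [J [d [qd ->]]]; exists J, (fun j => c * d j).
split; first by apply: diag_formZ qd; rewrite gt_eqF.
by under [RHS]eq_bigr do rewrite sgzM gtr0_sgz // mul1r.
Qed.

Lemma has_sigN (X : Type) (q : X -> X -> R) z :
  has_sig q z -> has_sig (fun x y => - q x y) (- z).
Proof.
move=> [J [d [qd ->]]]; exists J, (fun j => -1 * d j); split.
  apply: (@eq_diag_form _ _ (fun x y => -1 * q x y)) => [x y|].
    by rewrite mulN1r.
  by apply: diag_formZ qd; rewrite oppr_eq0 oner_eq0.
by rewrite -sumrN; apply: eq_bigr => j _; rewrite mulN1r sgzN.
Qed.

Lemma has_sig_transport (X X' : Type) (q : X -> X -> R) (q' : X' -> X' -> R)
    (J : X' -> seq (R * X)) z :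
    (forall x y, q' x y = blsum q (J x) (J y)) ->
    (forall u, exists s : seq (R * X'), forall w,
       q u w = lsum (fun x => lsum (q^~ w) (J x)) s) ->
  has_sig q z -> has_sig q' z.
Proof.
move=> q'E J_span [I [d [qd ->]]]; exists I, d; split=> //.
exact: (diag_form_transport (K := R) q'E J_span qd).
Qed.

Lemma has_sig_surj (X X' : Type) (q : X -> X -> R) (q' : X' -> X' -> R)
    (f : X' -> X) (g : X -> X') z :
    cancel g f -> (forall x y, q' x y = q (f x) (f y)) ->
  has_sig q z -> has_sig q' z.
Proof.
move=> gK q'E; apply: (@has_sig_transport _ _ _ _ (fun x => [:: (1, f x)])).
  by move=> x y; rewrite q'E /blsum !lsum1.
by move=> u; exists [:: (1, g u)] => w; rewrite !lsum1 gK.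
Qed.

Lemma eq_has_sig (X : Type) (q q' : X -> X -> R) z :
  (forall x y, q x y = q' x y) -> has_sig q z -> has_sig q' z.
Proof. by move=> qq'; apply: (@has_sig_surj _ _ _ _ id id) => // x y; rewrite qq'. Qed.

(** Points cannot be added, so the orthogonal decomposition is given by maps [p1], [p2] with
    sections. The image of one summand in the other need only lie in the radical: for pairs it is
    some [(0, y)], which is not a zero vector. *)
Lemma has_sig_sum (X X1 X2 : Type) (q : X -> X -> R) (q1 : X1 -> X1 -> R)
    (q2 : X2 -> X2 -> R) (i1 : X1 -> X) (i2 : X2 -> X) (p1 : X -> X1)
    (p2 : X -> X2) z1 z2 :
    cancel i1 p1 -> cancel i2 p2 ->
    (forall x y, q x y = q1 (p1 x) (p1 y) + q2 (p2 x) (p2 y)) ->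
    (forall x y, q1 (p1 (i2 x)) y = 0) -> (forall x y, q2 (p2 (i1 x)) y = 0) ->
  has_sig q1 z1 -> has_sig q2 z2 -> has_sig q (z1 + z2).
Proof.
move=> i1K i2K qE q12 q21.
move=> [J1 [d1 [[C1 [E1 [d10 qE1 CE1]]] ->]]] [J2 [d2 [[C2 [E2 [d20 qE2 CE2]]] ->]]].
(* A point of the radical has zero coordinates. *)
have Cz (Y : Type) (p : Y -> Y -> R) (J : finType) (d : J -> R) C E u j :
    (forall j, d j != 0) ->
    (forall x y, p x y = \sum_j C x j * d j * C y j) ->
    (forall i j, lsum (C^~ j) (E i) = (i == j)%:R) ->
    (forall y, p u y = 0) -> C u j = 0.
  move=> d0 pE CE p0; apply: (mulIf (d0 j)); rewrite mul0r.
  transitivity (lsum (p u) (E j)); last first.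
    by rewrite (eq_lsum _ p0) /lsum big1 // => r; rewrite mulr0.
  under eq_lsum do rewrite pE.
  rewrite lsum_sum (bigD1 j) //= big1 ?addr0 => [|i ij].
    by rewrite lsumMl CE eqxx mulr1.
  by rewrite lsumMl CE eq_sym (negPf ij) mulr0.
exists (J1 + J2)%type, (fun j => match j with inl j => d1 j | inr j => d2 j end).
split; last by rewrite big_sumType.
exists (fun x j => match j with inl j => C1 (p1 x) j | inr j => C2 (p2 x) j end).
exists (fun j => match j with
  | inl j => [seq (r.1, i1 r.2) | r <- E1 j]
  | inr j => [seq (r.1, i2 r.2) | r <- E2 j] end).
split=> [[]//|x y|]; first by rewrite qE qE1 qE2 big_sumType.
move=> [i|i] [j|j]; rewrite /lsum big_map /=.
- by rewrite -[RHS]CE1; apply: eq_bigr => r _; rewrite i1K.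
- by rewrite big1 // => r _; rewrite (Cz _ _ _ _ _ _ _ _ d20 qE2 CE2) ?mulr0.
- by rewrite big1 // => r _; rewrite (Cz _ _ _ _ _ _ _ _ d10 qE1 CE1) ?mulr0.
- by rewrite -[RHS]CE2; apply: eq_bigr => r _; rewrite i2K.
Qed.

End Inertia.

(** * The division algebras D_P *)

(* What L, L[i] and the quaternions have in common: pre is the real part, for
   which pbasis is orthonormal, and pkappa is the trace of t. *)
Record posalg (L : rcfType) (D : pzRingType) (t : involution D) := PosAlg {
  emb : L -> D;
  pdim : nat;
  pbasis : 'I_pdim -> D;
  pcoord : 'I_pdim -> D -> L;
  pre : D -> L;
  pkappa : int;
  pdim_gt0 : (0 < pdim)%N;
  embD : forall a b, emb (a + b) = emb a + emb b;
  embM : forall a b, emb (a * b) = emb a * emb b;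
  emb1 : emb 1 = 1;
  embC : forall a x, emb a * x = x * emb a;
  inv_emb : forall a, t (emb a) = emb a;
  pcoordD : forall p x y, pcoord p (x + y) = pcoord p x + pcoord p y;
  pcoordZ : forall p a x, pcoord p (emb a * x) = a * pcoord p x;
  pcoord_basis : forall p q, pcoord p (pbasis q) = (p == q)%:R;
  pcoordE : forall x, x = \sum_p emb (pcoord p x) * pbasis p;
  preD : forall x y, pre (x + y) = pre x + pre y;
  preZ : forall a x, pre (emb a * x) = a * pre x;
  pre1 : pre 1 = 1;
  preC : forall x y, pre (x * y) = pre (y * x);
  pre_inv : forall x, pre (t x) = pre x;
  pre_dot : forall x y, pre (t x * y) = \sum_p pcoord p x * pcoord p y;
  inv_sym : forall x, t x = x -> x = emb (pre x);
  ptrace : forall x, \sum_p pcoord p (x * pbasis p) = pdim%:R * pre x;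
  ptrace_inv : \sum_p pcoord p (t (pbasis p)) = pkappa%:~R
}.

Section Instances.
Variable L : rcfType.

Lemma real_posalg : {a : posalg L (id_inv L) | (pdim a, pkappa a) = (1%N, 1)}.
Proof.
unshelve eexists.
  unshelve refine (@PosAlg L L (id_inv L) id 1 (fun=> 1) (fun _ x => x) id 1
    _ _ _ _ _ _ _ _ _ _ _ _ _ _ _ _ _ _ _) => //=.
- by move=> a x; rewrite mulrC.
- by move=> p q; rewrite !ord1.
- by move=> x; rewrite big_ord1 mulr1.
- by move=> x y; rewrite mulrC.
- by move=> x y; rewrite big_ord1.
- by move=> x; rewrite big_ord1 mulr1 mul1r.
- by rewrite big_ord1.
by [].
Qed.

Definition cplx_coord (p : 'I_2) (x : L[i]) : L :=
  if val p is 0%N then let: Complex a _ := x in a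
  else let: Complex _ b := x in b.
Definition cplx_basis (p : 'I_2) : L[i] := if val p is 0%N then 1 else Complex 0 1.

Lemma complex_eq (x y : L[i]) :
  mathcomp.real_closed.complex.Re x = mathcomp.real_closed.complex.Re y ->
  mathcomp.real_closed.complex.Im x = mathcomp.real_closed.complex.Im y -> x = y.
Proof. by case: x y => a b [c d] /= -> ->. Qed.

Lemma complex_posalg :
  {a : posalg L (Defs.conjc_inv L) | (pdim a, pkappa a) = (2%N, 0)}.
Proof.
unshelve eexists.
  unshelve refine (@PosAlg L L[i] (Defs.conjc_inv L) (fun a => Complex a 0) 2 cplx_basis
    cplx_coord (@mathcomp.real_closed.complex.Re L) 0
    _ _ _ _ _ _ _ _ _ _ _ _ _ _ _ _ _ _ _) => //=.
all: rewrite /cplx_coord /cplx_basis.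
- by move=> a b; apply: complex_eq => /=; ring.
- by move=> a b; apply: complex_eq => /=; ring.
- by move=> a [b c]; apply: complex_eq => /=; ring.
- by move=> a; apply: complex_eq => /=; ring.
- by move=> p [a b] [c d]; case: (val p).
- by move=> p a [c d] /=; case: (val p) => /=[|_]; ring.
- by move=> [[|[|//]] ?] [[|[|//]] ?].
- move=> [a b]; rewrite !big_ord_recl big_ord0 /=.
  by apply: complex_eq => /=; ring.
- by move=> [a b] [c d].
- by move=> a [c d] /=; ring.
- by move=> [a b] [c d] /=; ring.
- by move=> [a b].
- by move=> [a b] [c d]; rewrite !big_ord_recl big_ord0 /=; ring.
- move=> [a b] /eqP; rewrite eq_complex /= => /andP[_ /eqP b0].
  apply: complex_eq => //=; lra.
- by move=> [a b]; rewrite !big_ord_recl big_ord0 /=; ring.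
- by rewrite !big_ord_recl big_ord0 /=; ring.
by [].
Qed.

Definition quat_coord (p : 'I_4) (x : quat L) : L :=
  nth 0 [:: qr x; qi x; qj x; qk x] p.
Definition quat_basis (p : 'I_4) : quat L :=
  nth 0 [:: Quat 1 0 0 0; Quat 0 1 0 0; Quat 0 0 1 0; Quat 0 0 0 1] p.

Lemma quat_posalg : {a : posalg L (quat_inv L) | (pdim a, pkappa a) = (4%N, -2)}.
Proof.
unshelve eexists.
  unshelve refine (@PosAlg L (quat L) (quat_inv L) (fun a => Quat a 0 0 0) 4
    quat_basis quat_coord (@qr L) (-2)
    _ _ _ _ _ _ _ _ _ _ _ _ _ _ _ _ _ _ _) => //=.
- by move=> a b; apply: quat_eq => /=; ring.
- by move=> a b; apply: quat_eq => /=; ring.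
- by move=> a [b c d e]; apply: quat_eq => /=; ring.
- by move=> a; apply: quat_eq => /=; ring.
- by move=> [[|[|[|[|//]]]] ?] [a b c d] [e f g h].
- by move=> [[|[|[|[|//]]]] ?] x [a b c d]; rewrite /quat_coord /=; ring.
- by move=> [[|[|[|[|//]]]] ?] [[|[|[|[|//]]]] ?].
- move=> [a b c d]; rewrite !big_ord_recl big_ord0.
  by apply: quat_eq; rewrite /quat_coord /quat_basis /=; ring.
- by move=> a [b c d e] /=; ring.
- by move=> [a b c d] [e f g h] /=; ring.
- by move=> [a b c d] [e f g h]; rewrite !big_ord_recl big_ord0 /quat_coord /=; ring.
- move=> [a b c d] [? ? ?]; apply: quat_eq => //=; lra.
- move=> [a b c d]; rewrite !big_ord_recl big_ord0 /quat_coord /quat_basis /=; ring.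
- rewrite !big_ord_recl big_ord0 /quat_coord /quat_basis /=; ring.
by [].
Qed.

End Instances.

(** * Diagonalization of hermitian forms *)

Section PosalgTheory.
Variables (L : rcfType) (D : pzRingType) (t : involution D) (a : posalg L t).
Implicit Types (x y : D) (l : L).

Local Notation emb := (emb a).
Local Notation re := (pre a).
Local Notation coord := (@pcoord _ _ _ a).

Lemma emb0 : emb 0 = 0.
Proof. by apply: (addrI (emb 0)); rewrite -embD !addr0. Qed.

Lemma embN l : emb (- l) = - emb l.
Proof. by apply: (addrI (emb l)); rewrite -embD !subrr emb0. Qed.

Lemma emb_nat n : emb n%:R = n%:R.
Proof. by elim: n => [|n IHn]; rewrite ?emb0 // !mulrS embD emb1 IHn. Qed.

Lemma emb_int z : emb z%:~R = z%:~R.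
Proof.
by case: z => n; rewrite ?NegzE ?rmorphN ?embN -?pmulrn ?emb_nat.
Qed.

Lemma pre0 : re 0 = 0.
Proof. by apply: (addrI (re 0)); rewrite -preD !addr0. Qed.

Lemma pre_emb l : re (emb l) = l.
Proof. by rewrite -[emb l]mulr1 preZ pre1 mulr1. Qed.

Lemma pcoord0 p : coord p 0 = 0.
Proof. by apply: (addrI (coord p 0)); rewrite -pcoordD !addr0. Qed.

Lemma pre_sum (I : finType) (f : I -> D) : re (\sum_i f i) = \sum_i re (f i).
Proof. by apply: (big_morph re (preD a) pre0). Qed.

Lemma inv_mulE x : t x * x = emb (\sum_p coord p x ^+ 2).
Proof. by rewrite [LHS](inv_sym a) ?pre_dot // invM invK. Qed.

Lemma pcoord_sq_gt0 x : x != 0 -> 0 < \sum_p coord p x ^+ 2.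
Proof.
move=> x0; rewrite lt0r sumr_ge0 ?andbT => [|p _]; last exact: sqr_ge0.
apply: contraNneq x0 => /eqP; rewrite psumr_eq0 => [/allP s0|p _].
  rewrite [x](pcoordE a) big1 // => p _.
  have := s0 p; rewrite mem_index_enum sqrf_eq0 => /(_ isT)/eqP->.
  by rewrite emb0 mul0r.
exact: sqr_ge0.
Qed.

End PosalgTheory.

Section HFormLemmas.
Variables (R : pzRingType) (s : involution R) (e : bool) (h : hform s e).

Lemma hform_sumr (I : Type) (r : seq I) (F : I -> hmod h) x :
  h x (\sum_(i <- r) F i) = \sum_(i <- r) h x (F i).
Proof. exact: (big_morph (h x) (hformDr x) (hform0r x)). Qed.

Lemma hform_suml (I : Type) (r : seq I) (F : I -> hmod h) x :
  h (\sum_(i <- r) F i) x = \sum_(i <- r) h (F i) x.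
Proof. exact: (big_morph (h^~ x) (fun y z => hformDl y z x) (hform0l x)). Qed.

Lemma hformNr x y : h x (- y) = - h x y.
Proof. by apply: (addrI (h x y)); rewrite -hformDr !subrr hform0r. Qed.

Lemma hform_eq0 x : (forall y, h y x = 0) -> x = 0.
Proof.
have [I [u [v uv]]] := hform_dual_basis h.
by move=> h0; rewrite [x]uv big1 // => i _; rewrite h0 /rscale scale0r.
Qed.

Lemma rscaleDr (M : rmodType R) (x : M) a b : x *> (a + b) = x *> a + x *> b.
Proof. exact: scalerDl. Qed.

Lemma rscaleA (M : rmodType R) (x : M) a b : x *> a *> b = x *> (a * b).
Proof. exact: scalerA. Qed.

Lemma rscale0 (M : rmodType R) (x : M) : x *> 0 = 0.
Proof. exact: scale0r. Qed.

Lemma rscale_suml (M : rmodType R) (I : Type) (r : seq I) (F : I -> M) a :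
  (\sum_(i <- r) F i) *> a = \sum_(i <- r) F i *> a.
Proof. exact: scaler_sumr. Qed.

Lemma rscale_sumr (M : rmodType R) (I : Type) (r : seq I) (F : I -> R) (x : M) :
  x *> (\sum_(i <- r) F i) = \sum_(i <- r) x *> F i.
Proof. exact: (big_morph (rscale x) (rscaleDr x) (rscale0 x)). Qed.

End HFormLemmas.

Section Diagonalization.
Variables (L : rcfType) (D : pzRingType) (t : involution D) (a : posalg L t).
Variable h : hform t false.

Local Notation emb := (emb a).
Local Notation re := (pre a).
Local Notation coord := (@pcoord _ _ _ a).

Definition orthonormal n (e : 'I_n -> hmod h) (al : 'I_n -> int) : Prop :=
  (forall i, al i = 1 \/ al i = -1) /\
  (forall i j, h (e i) (e j) = (al i)%:~R *+ (i == j)).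

Definition orthonormal_basis n (e : 'I_n -> hmod h) (al : 'I_n -> int) : Prop :=
  orthonormal e al /\ forall m, m = \sum_i e i *> ((al i)%:~R * h (e i) m).

Lemma herm_swap x y : h y x = t (h x y).
Proof. by rewrite hformC expr0 mul1r. Qed.

Lemma sign_sqr (al : int) : al = 1 \/ al = -1 -> (al%:~R * al%:~R : D) = 1.
Proof. by case=> ->; rewrite -intrM. Qed.

Lemma re_hform_finite_rank :
  exists I : finType, finite_rank (fun x y => re (h x y)) I.
Proof.
have [I [u [v uv]]] := hform_dual_basis h.
exists (I * 'I_(pdim a))%type.
exists (fun k x => coord k.2 (h (u k.1) x)), (fun k y => coord k.2 (h (v k.1) y)).
move=> x y; rewrite {1}(uv y) hform_sumr pre_sum.
rewrite -(pair_bigA _ (fun i p => coord p (h (u i) x) * coord p (h (v i) y))) /=.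
by apply: eq_bigr => i _; rewrite hformZr herm_swap pre_dot.
Qed.

(** An orthonormal family is orthogonal and nonisotropic for the L-valued form [re (h x y)], which
    has finite rank; this replaces a dimension count over [D]. *)
Lemma orthonormal_bounded :
  exists N, forall n (e : 'I_n -> hmod h) al, orthonormal e al -> (n <= N)%N.
Proof.
have [I rI] := re_hform_finite_rank; exists #|I| => n e al [al1 eE].
apply: (orthogonal_family_bound rI (e := e)) => [i j ij|i].
  by rewrite eE (negPf ij) pre0.
rewrite eE eqxx mulr1n -(emb_int a) pre_emb.
by case: (al1 i) => ->; rewrite ?oppr_eq0 oner_eq0.
Qed.

(* Polarization. *)
Lemma isotropic_eq0 (S : hmod h -> Prop) :
    (forall x y, S x -> S y -> S (x + y)) -> (forall x d, S x -> S (x *> d)) ->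
    (forall x, S x -> h x x = 0) ->
  forall x y, S x -> S y -> h x y = 0.
Proof.
move=> SD SZ S0 x y Sx Sy; apply/eqP; apply: contrapT => /negP hxy.
have := S0 _ (SD _ _ Sx (SZ _ (t (h x y)) Sy)).
rewrite hformDl !hformDr hformZr hformZl invK (herm_swap x y) (S0 x Sx) add0r.
rewrite (S0 _ (SZ _ _ Sy)) addr0 => /(congr1 re).
rewrite preD pre0 preC (inv_mulE a) pre_emb => /eqP.
rewrite -mulr2n mulrn_eq0 /= gt_eqF // pcoord_sq_gt0 //.
Qed.

(** A maximal orthonormal family is a basis. On its orthogonal complement [S] a nonzero value
    [h x x] is a scalar of L, and rescaling [x] by a square root would normalize it to a sign and
    extend the family. So [S] is totally isotropic, and nonsingularity makes it zero. *)
Lemma hform_diag : exists n (e : 'I_n -> hmod h) al, orthonormal_basis e al.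
Proof.
pose P n := `[< exists (e : 'I_n -> hmod h) al, orthonormal e al >].
have P0 : exists n, P n.
  by exists 0%N; apply/asboolP; exists (fun=> 0), (fun=> 1); split=> [[]|[]].
have [N Nb] := orthonormal_bounded.
have P_bound n : P n -> (n <= N)%N by move=> /asboolP[e [al /Nb]].
case: (ex_maxnP P0 P_bound) => n /asboolP[e [al eal]] n_max.
have [al1 eE] := eal.
exists n, e, al; split=> // m.
pose S x := forall i, h (e i) x = 0.
pose proj x := x - \sum_i e i *> ((al i)%:~R * h (e i) x).
have Sproj x : S (proj x).
  move=> i; rewrite hformDr hformNr hform_sumr (bigD1 i) //= big1 ?addr0.
    by rewrite hformZr eE eqxx mulr1n mulrA sign_sqr // mul1r subrr.
  by move=> j ji; rewrite hformZr eE eq_sym (negPf ji) mul0r.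
have SD x y : S x -> S y -> S (x + y).
  by move=> Sx Sy i; rewrite hformDr Sx Sy addr0.
have SZ x d : S x -> S (x *> d) by move=> Sx i; rewrite hformZr Sx mul0r.
have S0 x : S x -> h x x = 0.
  move=> Sx; apply/eqP; apply: contrapT => /negP hx.
  suff /asboolP/n_max : exists (e : 'I_n.+1 -> hmod h) al, orthonormal e al.
    by rewrite ltnn.
  have hxE : h x x = emb (re (h x x)) by apply: inv_sym; rewrite -herm_swap.
  set r := re (h x x) in hxE.
  have r0 : r != 0 by apply: contraNneq hx => r0; rewrite hxE r0 emb0.
  pose c := (Num.sqrt `|r|)^-1.
  have cE : c * r * c = (sgz r)%:~R.
    rewrite mulrAC -expr2 exprVn sqr_sqrtr ?normr_ge0 // -sgrEz.
    by rewrite {2}[r]numEsg mulrCA mulVf ?mulr1 // normr_eq0.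
  exists (fun i => oapp e (x *> emb c) (unlift ord0 i)).
  exists (fun i => oapp al (sgz r) (unlift ord0 i)); split=> [i|i j].
    by case: unliftP => [k _|_] /=; [apply: al1|case: sgzP r0; auto].
  case: unliftP => [i' ->|->]; case: unliftP => [j' ->|->] /=.
  - by rewrite (inj_eq lift_inj) eE.
  - by rewrite hformZr Sx mul0r.
  - by rewrite hformZl herm_swap Sx Defs.inv0 mulr0.
  - by rewrite hformZ inv_emb hxE -!embM cE emb_int.
suff proj0 : proj m = 0 by apply/eqP; rewrite -subr_eq0 -/(proj m) proj0.
apply: (@hform_eq0 _ _ _ h) => y.
have yE : y = proj y + \sum_i e i *> ((al i)%:~R * h (e i) y) by rewrite subrK.
rewrite yE hformDl (isotropic_eq0 SD SZ S0) // add0r hform_suml big1 // => i _.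
by rewrite hformZl Sproj mulr0.
Qed.

Lemma orthonormal_diagonalization n (e : 'I_n -> hmod h) al :
  orthonormal_basis e al -> diagonalization h al.
Proof.
move=> [[al1 eE] eP].
pose f (m : hmod h) : 'rV[D^c]_n := \row_i ((al i)%:~R * h (e i) m : D^c).
have f_lin : linear f.
  move=> c x y; apply/rowP=> i; rewrite !mxE hformDr mulrDr; congr (_ + _).
  by rewrite -[c *: x]/(x *> c) hformZr mulrA.
pose fl : {linear hmod h -> 'rV[D^c]_n} :=
  HB.pack f (GRing.isLinear.Build D^c (hmod h) 'rV[D^c]_n _ f f_lin).
exists fl; split.
  exists (fun r : 'rV[D^c]_n => \sum_i e i *> r 0 i) => [m|r].
    by rewrite [RHS]eP; apply: eq_bigr => i _; rewrite mxE.
  apply/rowP=> i; rewrite mxE hform_sumr (bigD1 i) //= big1 ?addr0 => [|j ji].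
    by rewrite hformZr eE eqxx mulr1n mulrA sign_sqr // mul1r.
  by rewrite hformZr eE eq_sym (negPf ji) mul0r.
move=> x y; rewrite {1}(eP x) {1}(eP y) hform_suml; apply: eq_bigr => i _.
rewrite hform_sumr (bigD1 i) //= big1 ?addr0 => [|j ji].
  by rewrite hformZ eE eqxx mulr1n !mxE.
by rewrite hformZ eE eq_sym (negPf ji) mulr0 mul0r.
Qed.

(** A diagonalization exists, so [diag_sign] is the sum of one of them and not the default 0 of
    [xget]. *)
Lemma diag_signP : exists n (al : 'I_n -> int),
  [/\ forall i, al i = 1 \/ al i = -1, diagonalization h al
    & diag_sign h = \sum_i al i].
Proof.
have [n [e [al eal]]] := hform_diag.
have : [set z | exists n (al : 'I_n -> int), [/\ forall i, al i = 1 \/ al i = -1,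
    diagonalization h al & z = \sum_i al i]]%classic (diag_sign h).
  apply: xgetPex; exists (\sum_i al i), n, al; split=> //.
    by case: eal => -[].
  exact: orthonormal_diagonalization eal.
by [].
Qed.

End Diagonalization.

(* The form on pairs induced by the form h (x) h0 on M (x) M0, the latter being
   a left module through the involution. *)
Definition pair_form (R : pzRingType) (s : involution R) (e : bool)
    (T : Type) (tr : R -> T) (h h0 : hform s e) (x y : hmod h * hmod h0) : T :=
  tr (h x.1 y.1 * h0 y.2 x.2).

Section PairForm.
Variables (L : rcfType) (D : pzRingType) (t : involution D) (a : posalg L t).
Variables h h0 : hform t false.

Local Notation emb := (emb a).
Local Notation re := (pre a).
Local Notation coord := (@pcoord _ _ _ a).

Lemma pre_intl (z : int) x : re (z%:~R * x) = z%:~R * re x.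
Proof. by rewrite -(emb_int a) preZ. Qed.

Lemma intC (z : int) (x : D) : z%:~R * x = x * z%:~R.
Proof. by rewrite -(emb_int a) embC. Qed.

(** For coordinates x_i of x.1 and y_j of x.2, invariance of [re] under cyclic permutation makes the
    form the sum over i, j of al_i al0_j times the standard positive definite form of [D] at x_i
    t(y_j). Each (i, j) thus contributes [pdim a] equal entries. A dual point has [pbasis p] in
    place i of the first vector and 1 in place j of the second. *)
Lemma pair_form_sig n n0 (al : 'I_n -> int) (al0 : 'I_n0 -> int) :
    (forall i, al i = 1 \/ al i = -1) -> (forall i, al0 i = 1 \/ al0 i = -1) ->
    diagonalization h al -> diagonalization h0 al0 ->
  has_sig (pair_form re (h := h) (h0 := h0))
    ((pdim a)%:Z * (\sum_i al i) * (\sum_j al0 j)).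
Proof.
move=> al1 al01 [f [[g fK gK] fE]] [f0 [[g0 f0K g0K] f0E]].
pose I := ('I_n * ('I_n0 * 'I_(pdim a)))%type.
pose d (k : I) : L := (al k.1 * al0 k.2.1)%:~R.
exists I, d; split; last first.
  rewrite -(pair_bigA _ (fun i k => sgz (d (i, k)))) /=.
  rewrite mulrAC mulrC mulr_suml; apply: eq_bigr => i _.
  rewrite -(pair_bigA _ (fun j p => sgz (d (i, (j, p))))) /=.
  rewrite mulr_sumr mulr_sumr; apply: eq_bigr => j _.
  rewrite /d /= sumr_const card_ord sgz_int -mulr_natl natz mulrCA; congr (_ * _).
  by case: (al1 i) => ->; case: (al01 j) => ->.
exists (fun (x : hmod h * hmod h0) (k : I) =>
  coord k.2.2 ((f x.1 0 k.1 : D) * t (f0 x.2 0 k.2.1))).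
exists (fun k : I => [:: ((1 : L),
  (g (\row_i (pbasis k.2.2 *+ ((i : 'I_n) == k.1) : D^c)),
   g0 (\row_j ((1 : D) *+ ((j : 'I_n0) == k.2.1) : D^c))))]).
split=> [k|x y|k l].
- rewrite /d intr_eq0 mulf_neq0 //.
    by case: (al1 k.1) => ->.
  by case: (al01 k.2.1) => ->.
- rewrite /pair_form fE f0E mulr_suml pre_sum.
  rewrite -(pair_bigA _ (fun i k => coord k.2 ((f x.1 0 i : D) * t (f0 x.2 0 k.1)) *
    d (i, k) * coord k.2 ((f y.1 0 i : D) * t (f0 y.2 0 k.1)))) /=.
  apply: eq_bigr => i _; rewrite mulr_sumr pre_sum.
  rewrite -(pair_bigA _ (fun j p => coord p ((f x.1 0 i : D) * t (f0 x.2 0 j)) *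
    d (i, (j, p)) * coord p ((f y.1 0 i : D) * t (f0 y.2 0 j)))) /=.
  apply: eq_bigr => j _.
  rewrite -!(intC (al _)) -!(intC (al0 _)) -!mulrA pre_intl.
  rewrite [X in re X]mulrA [X in re X]mulrA -intC -!mulrA pre_intl mulrA -intrM.
  rewrite preC -!mulrA preC -!mulrA preC -!mulrA.
  rewrite [X in re X](_ : _ = t ((f x.1 0 i : D) * t (f0 x.2 0 j)) *
    ((f y.1 0 i : D) * t (f0 y.2 0 j))); last by rewrite invM invK !mulrA.
  rewrite pre_dot mulr_sumr; apply: eq_bigr => p _.
  by rewrite /d /= mulrCA mulrA.
rewrite lsum1 /= gK g0K !mxE.
case: k => i [j p]; case: l => i' [j' p'] /=; rewrite !xpair_eqE.
rewrite eq_sym [j' == j]eq_sym.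
have [_|_] := eqVneq i i'; last by rewrite mul0r pcoord0.
have [_|_] := eqVneq j j'; last by rewrite Defs.inv0 mulr0 pcoord0.
by rewrite Defs.inv1 mulr1 pcoord_basis eq_sym.
Qed.

End PairForm.

(** * Morita bimodules *)

Section MoritaBimodule.
Variables (L : rcfType) (D : pzRingType) (t : involution D) (a : posalg L t).
Variables (B : pzRingType) (s : involution B) (V : hbimodule s t false).
Hypothesis V_morita : morita_bimodule V.
Variables (N : nat) (e : 'I_N -> hmod V) (al : 'I_N -> int).
Hypothesis e_basis : orthonormal_basis (h := V) e al.

Local Notation emb := (emb a).
Local Notation re := (pre a).
Local Notation coord := (@pcoord _ _ _ a).
Local Notation act := (bim_act V).

Lemma e_expand v : v = \sum_k e k *> ((al k)%:~R * V (e k) v).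
Proof. by case: e_basis. Qed.

Lemma e_ortho k l : V (e k) (e l) = (al k)%:~R *+ (k == l).
Proof. by case: e_basis => -[]. Qed.

Lemma al_sqr k : ((al k)%:~R * (al k)%:~R : D) = 1.
Proof. by apply: sign_sqr; case: e_basis => -[]. Qed.

Lemma bim_actS b v d : act b (v *> d) = act b v *> d.
Proof. exact: linear_rscale. Qed.

Lemma bim_act_inj b c : (forall v, act b v = act c v) -> b = c.
Proof.
move=> bc; have [b' [_ b'u]] := (V_morita.2 (act b)).
by rewrite -(b'u b) // -(b'u c).
Qed.

Lemma bim_endo (g : hmod V -> hmod V) :
    (forall v w, g (v + w) = g v + g w) -> (forall v d, g (v *> d) = g v *> d) ->
  exists b, forall w, act b w = g w.
Proof.
move=> gD gZ; have g_lin : linear g.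
  by move=> d v w; rewrite gD; congr (_ + _); apply: gZ.
have [b [bE _]] := V_morita.2 (HB.pack g
  (GRing.isLinear.Build D^c (hmod V) (hmod V) _ g g_lin)).
by exists b => w; rewrite -bE.
Qed.

Lemma bim_rank_one v v' : exists b, forall w, act b w = v *> V v' w.
Proof.
apply: bim_endo => [w w'|w d]; first by rewrite hformDr rscaleDr.
by rewrite hformZr rscaleA.
Qed.

Lemma bim_dim_gt0 : (0 < N)%N.
Proof.
rewrite lt0n; apply/eqP=> N0; have [[n [f [v fv]]] _] := V_morita.
have V0 (w : hmod V) : w = 0.
  by rewrite [w]e_expand big1 // => k; have := ltn_ord k; rewrite {2}N0.
have : re 1 = 0.
  transitivity (re (\sum_i f i (v i))); first by rewrite fv.
  by rewrite big1 ?pre0 // => i _; rewrite [v i]V0 linear0.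
by rewrite pre1 => /eqP; rewrite oner_eq0.
Qed.

(* The reduced trace of B (up to a factor), computed through B = End_D V. *)
Definition bim_trace (b : B) : L := \sum_k re ((al k)%:~R * V (e k) (act b (e k))).

Lemma bim_traceV b : bim_trace (s b) = bim_trace b.
Proof.
apply: eq_bigr => k _; rewrite -bim_adj herm_swap !(pre_intl a); congr (_ * _).
exact: pre_inv.
Qed.

Section Pairs.
Variables h h0 : hform s false.

Local Notation ra := (@rscale B (hmod h)).
Local Notation ra0 := (@rscale B (hmod h0)).
Local Notation q := (pair_form re (h := htens V h) (h0 := htens V h0)).

(** Inserts the canonical element, the sum of the e_k al_k (x) e_k, between the two factors. It
    represents the identity of [V] under the identification of B with V (x)_D V, the second factor
    being conjugated. *)
Definition pair_dual (x : hmod h * hmod h0) :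
    seq (L * (hmod (htens V h) * hmod (htens V h0))) :=
  [seq ((al k)%:~R, (tmul ra act x.1 (e k), tmul ra0 act x.2 (e k))) | k : 'I_N].

Lemma lsum_pair_dual (f : hmod (htens V h) * hmod (htens V h0) -> L) x :
  lsum f (pair_dual x) =
  \sum_k (al k)%:~R * f (tmul ra act x.1 (e k), tmul ra0 act x.2 (e k)).
Proof. by rewrite /lsum big_image. Qed.

(** The trace of a product of two operators on [V], written out with their matrix entries in the
    basis [e]. *)
Lemma pair_dualE x y :
  pair_form bim_trace x y = blsum q (pair_dual x) (pair_dual y).
Proof.
rewrite /blsum lsum_pair_dual; apply: eq_bigr => k _.
rewrite pre_intl lsum_pair_dual; congr (_ * _).
rewrite bim_actM [act (h0 _ _) _]e_expand linear_sum hform_sumr pre_sum.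
apply: eq_bigr => l _; rewrite bim_actS hformZr mulrA -(intC a) -!mulrA.
by rewrite pre_intl /pair_form /= !htens_valE.
Qed.

Lemma pair_formDl (u u' : hmod (htens V h)) u0 w :
  q (u + u', u0) w = q (u, u0) w + q (u', u0) w.
Proof. by rewrite /pair_form /= htens_valDl mulrDl preD. Qed.

Lemma pair_formDr u (u0 u0' : hmod (htens V h0)) w :
  q (u, u0 + u0') w = q (u, u0) w + q (u, u0') w.
Proof. by rewrite /pair_form /= htens_valDr mulrDr preD. Qed.

Lemma pair_form_bal (u : hmod (htens V h)) (u0 : hmod (htens V h0)) d w :
  q (u *> d, u0) w = q (u, u0 *> t d) w.
Proof.
rewrite /pair_form /= -[htens_val _ w.1]/(htens V h (u *> d) w.1).
rewrite -[htens_val _ (_ *> _)]/(htens V h0 w.2 (u0 *> t d)).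
by rewrite hformZl hformZr -mulrA preC mulrA.
Qed.

Lemma pair_formZ (u : hmod (htens V h)) (u0 : hmod (htens V h0)) l w :
  q (u *> emb l, u0) w = l * q (u, u0) w.
Proof.
rewrite /pair_form /= -[htens_val _ w.1]/(htens V h (u *> emb l) w.1).
by rewrite hformZl inv_emb -mulrA preZ.
Qed.

Lemma pair_formZr (u : hmod (htens V h)) (u0 : hmod (htens V h0)) l w :
  q (u, u0 *> emb l) w = l * q (u, u0) w.
Proof. by rewrite -pair_formZ pair_form_bal inv_emb. Qed.

Lemma pair_form_sumr u (I : Type) (r : seq I) (F : I -> hmod (htens V h0)) w :
  q (u, \sum_(i <- r) F i) w = \sum_(i <- r) q (u, F i) w.
Proof.
apply: (big_morph (fun u0 => q (u, u0) w)) => [x y|]; first exact: pair_formDr.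
by rewrite /pair_form /= [htens_val _ 0](hform0r (h := htens V h0)) mulr0 pre0.
Qed.

(** [b] is the rank one operator sending w to [v *> V v' w]. Expanding [v'] along [e] and moving the
    coefficients across the balanced product turns the given pair of tensors into the image of
    [(x *> b, y)]. *)
Lemma pair_dual_span x y v v' : exists b, forall w,
  q (tmul ra act x v, tmul ra0 act y v') w =
  lsum (q^~ w) (pair_dual (x *> b, y)).
Proof.
have [b bE] := bim_rank_one v v'; exists b => w.
rewrite lsum_pair_dual /=.
rewrite [in LHS](e_expand v').
have -> : tmul ra0 act y (\sum_k e k *> ((al k)%:~R * V (e k) v')) =
    \sum_k tmul ra0 act y (e k *> ((al k)%:~R * V (e k) v')).
  exact: (big_morph _ (tmulDr _ _ _) (tmul0r _ _ _)).
rewrite pair_form_sumr; apply: eq_bigr => k _.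
rewrite [in RHS]tmul_bal bE -!tmul_rscale pair_form_bal -herm_swap (intC a).
by rewrite -rscaleA -(emb_int a) pair_formZr.
Qed.

End Pairs.

End MoritaBimodule.

(** * Extension of scalars *)

(** The kernel of a matrix over F, extended to L, is the kernel over L; hence solutions confined to
    the line of [r] stay confined to it. *)
Lemma system_scalext (F L : fieldType) (iota : {rmorphism F -> L}) n (I : finType)
    (K : 'I_n -> I -> F) (r : 'I_n -> F) :
    (forall v : 'I_n -> F, (forall p, \sum_i v i * K i p = 0) ->
       exists c, forall i, v i = c * r i) ->
  forall v : 'I_n -> L, (forall p, \sum_i v i * iota (K i p) = 0) ->
    exists c, forall i, v i = c * iota (r i).
Proof.
move=> Fsol v vK.
pose M := \matrix_(i < n, p < #|I|) K i (enum_val p).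
have kerM : (kermx M <= \row_i r i)%MS.
  apply/row_subP=> k; have /sub_kermxP/rowP kM : (row k (kermx M) <= kermx M)%MS.
    exact: row_sub.
  have [p|c cE] := Fsol (fun i => kermx M k i).
    have := kM (enum_rank p); rewrite !mxE => eq0; rewrite -[RHS]eq0.
    by apply: eq_bigr => i _; rewrite !mxE enum_rankK.
  apply/sub_rVP; exists c; apply/rowP=> i; rewrite !mxE -cE.
  by rewrite /= mxE.
have : (\row_i v i <= map_mx iota (\row_i r i))%MS.
  apply: submx_trans (_ : (map_mx iota (kermx M) <= _)%MS); last by rewrite map_submx.
  rewrite map_kermx; apply/sub_kermxP/rowP=> p; rewrite !mxE -[RHS](vK (enum_val p)).
  by apply: eq_bigr => i _; rewrite !mxE.
case/sub_rVP=> c /rowP cE; exists c => i.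
by have := cE i; rewrite !mxE.
Qed.

Section Scalext.
Variables (F L : fieldType) (iota : {rmorphism F -> L}) (A : falgType F).

Local Notation AL := (scalext iota A).
Local Notation sm := (@smul F L iota A).
Local Notation b := (vbasis {:A}).

Lemma smulDl a a' l : sm (a + a') l = sm a l + sm a' l.
Proof. exact: tmulDl. Qed.

Lemma smulDr a l l' : sm a (l + l') = sm a l + sm a l'.
Proof. exact: tmulDr. Qed.

Lemma smul0l l : sm 0 l = 0.
Proof. exact: tmul0l. Qed.

Lemma smulNl a l : sm (- a) l = - sm a l.
Proof. by apply: (addrI (sm a l)); rewrite -smulDl !subrr smul0l. Qed.

Lemma smulZ c a l : sm (c *: a) l = sm a (iota c * l).
Proof. exact: tmul_bal. Qed.

Lemma smul_suml (I : Type) (r : seq I) (f : I -> A) l :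
  sm (\sum_(i <- r) f i) l = \sum_(i <- r) sm (f i) l.
Proof. exact: (big_morph (sm^~ l) (fun x y => smulDl x y l) (smul0l l)). Qed.

Lemma smul_sumr (I : Type) (r : seq I) (f : I -> L) a :
  sm a (\sum_(i <- r) f i) = \sum_(i <- r) sm a (f i).
Proof. apply: (big_morph (sm a) (smulDr a)); exact: tmul0r. Qed.

Lemma smul_ind (x : AL) : exists r : seq (A * L), x = \sum_(p <- r) sm p.1 p.2.
Proof. by exists (repr x); rewrite -{1}[x]reprK tens_piE. Qed.

Definition coordL (i : 'I_(\dim {:A})) : AL -> L :=
  tlift (fun (a : A) (l : L^o) => iota (coord b i a) * l).

Lemma coordL_bal i : balanced (@scalext_ra F A) (@scalext_la F L iota)
  (fun (a : A) (l : L^o) => iota (coord b i a) * l).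
Proof.
split; first split=> [a a' l|a l l'].
- by rewrite linearD rmorphD mulrDl.
- by rewrite mulrDr.
- move=> a c l; rewrite /scalext_ra linearZ /= rmorphM.
  by rewrite /GRing.scale /= mulrCA mulrA.
Qed.

Lemma coordL_smul i a l : coordL i (sm a l) = iota (coord b i a) * l.
Proof. exact/tliftE/coordL_bal. Qed.

Lemma coordLD i x y : coordL i (x + y) = coordL i x + coordL i y.
Proof. exact/tliftD/coordL_bal. Qed.

Lemma coordL0 i : coordL i 0 = 0.
Proof. by apply: (addrI (coordL i 0)); rewrite -coordLD !addr0. Qed.

Lemma coordL_sum (I : Type) (r : seq I) (f : I -> AL) i :
  coordL i (\sum_(j <- r) f j) = \sum_(j <- r) coordL i (f j).
Proof. exact: (big_morph (coordL i) (coordLD i) (coordL0 i)). Qed.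

Lemma scalext_expand x : x = \sum_(i < \dim {:A}) sm b`_i (coordL i x).
Proof.
have [r ->] := smul_ind x.
under [RHS]eq_bigr do rewrite coordL_sum smul_sumr.
rewrite exchange_big; apply: eq_bigr => p _ /=.
rewrite {1}(coord_vbasis (memvf p.1)) smul_suml; apply: eq_bigr => i _.
by rewrite coordL_smul smulZ.
Qed.

Lemma smul1C l (x : AL) : sm 1 l * x = x * sm 1 l.
Proof.
rewrite [x]scalext_expand mulr_sumr mulr_suml; apply: eq_bigr => i _.
by rewrite !smulM mulr1 mul1r mulrC.
Qed.

Lemma smul1E a l : sm a l = sm 1 l * sm a 1.
Proof. by rewrite smulM mul1r mulr1. Qed.

Lemma coordLZ i l x : coordL i (sm 1 l * x) = l * coordL i x.
Proof.
rewrite [x]scalext_expand mulr_sumr !coordL_sum mulr_sumr.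
apply: eq_bigr => j _.
by rewrite smulM mul1r !coordL_smul mulrCA.
Qed.

Definition trF (E : A -> A) : F := \sum_i coord b i (E b`_i).

(* psi stands for the coordinates in the family w, up to the twist tau. *)
Lemma trace_dual_family (E : A -> A) (EL : AL -> AL) (J : finType) (L' : fieldType)
    (tau : {rmorphism L -> L'}) (w : J -> AL) (psi : J -> AL -> L') :
    (forall x y, EL (x + y) = EL x + EL y) ->
    (forall l x, EL (sm 1 l * x) = sm 1 l * EL x) ->
    (forall a, EL (sm a 1) = sm (E a) 1) ->
    (forall j x y, psi j (x + y) = psi j x + psi j y) ->
    (forall j l x, psi j (sm 1 l * x) = tau l * psi j x) ->
    (forall x, exists2 c : J -> L, (forall j, tau (c j) = psi j x) &
       x = \sum_j sm 1 (c j) * w j) ->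
  tau (iota (trF E)) = \sum_j psi j (EL (w j)).
Proof.
move=> ELD ELZ ELE psiD psiZ psi_span.
have psi0 j : psi j 0 = 0 by apply: (addrI (psi j 0)); rewrite -psiD !addr0.
have psi_sum j (I : finType) (f : I -> AL) : psi j (\sum_i f i) = \sum_i psi j (f i).
  exact: (big_morph (psi j) (psiD j) (psi0 j)).
have EL0 : EL 0 = 0 by apply: (addrI (EL 0)); rewrite -ELD !addr0.
have EL_sum (I : finType) (f : I -> AL) : EL (\sum_i f i) = \sum_i EL (f i).
  exact: (big_morph EL ELD EL0).
have coord_psi i x : tau (coordL i x) = \sum_j psi j x * tau (coordL i (w j)).
  have [c cE xE] := psi_span x; rewrite {1}xE coordL_sum rmorph_sum.
  by apply: eq_bigr => j _; rewrite coordLZ rmorphM cE.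
transitivity (tau (\sum_(i < \dim {:A}) coordL i (EL (sm b`_i 1)))).
  rewrite /trF rmorph_sum; congr (tau _); apply: eq_bigr => i _.
  by rewrite ELE coordL_smul mulr1.
rewrite rmorph_sum; under eq_bigr do rewrite /= coord_psi.
rewrite exchange_big; apply: eq_bigr => j _ /=.
rewrite [in RHS](scalext_expand (w j)) EL_sum psi_sum; apply: eq_bigr => i _.
by rewrite [in RHS]smul1E ELZ psiZ mulrC.
Qed.

End Scalext.

(** * Symmetric central elements and their behaviour under extension of scalars *)

Section Centre.
Variables (F L : fieldType) (iota : {rmorphism F -> L}) (A : falgType F).
Variable s : alg_involution A.

Local Notation sm := (@smul F L iota A).
Local Notation b := (vbasis {:A}).

(** In the unitary case write x = k + l z with z the square root generating the centre. If l were
    nonzero, [s] would fix z and hence the whole centre. *)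
Lemma sym_centre (x : A) : (forall y, x * y = y * x) -> s x = x ->
  exists c, x = c%:A.
Proof.
move=> xC sx; have xZ : x \in 'Z({:A})%VS.
  by rewrite memv_cap memvf; apply/centvP=> y _; rewrite xC.
have [Z1|[d [_ [z [_ Z1]] [c cZ sc]]]] := alg_center s.
  by apply/vlineP; rewrite -Z1.
have sa (k : F) : s k%:A = k%:A by rewrite alg_invZ Defs.inv1.
move: xZ cZ; rewrite Z1 => /memv_addP[_ /vlineP[k ->] [_ /vlineP[l ->] xE]].
move=> /memv_addP[_ /vlineP[k' ->] [_ /vlineP[l' ->] cE]].
have [l0|l0] := eqVneq l 0; first by exists k; rewrite xE l0 scale0r addr0.
case/eqP: sc; rewrite cE invD sa alg_invZ; congr (_ + _ *: _).
move: sx; rewrite xE invD sa => /addrI; rewrite alg_invZ.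
exact: scalerI.
Qed.

(** Commuting with a basis of A and being fixed by the involution are linear equations over F on the
    coordinates of x, so [sym_centre] carries over to L by [system_scalext]. *)
Lemma sym_centre_scalext (x : scalext iota A) :
    (forall a, x * sm a 1 = sm a 1 * x) -> scalext_inv iota s x = x ->
  exists l, x = sm 1 l.
Proof.
move=> xC sx.
pose n := \dim {:A}.
pose cond (a : A) (p : 'I_n * 'I_n + 'I_n) : F := match p with
  | inl (j, m) => coord b m (a * b`_j - b`_j * a) | inr m => coord b m (s a - a) end.
have coord_eq0 (y : A) : (forall m, coord b m y = 0) -> y = 0.
  by move=> y0; rewrite (coord_vbasis (memvf y)) big1 // => i _; rewrite y0 scale0r.
have cond_sum (v : 'I_n -> F) p :
      \sum_i v i * cond b`_i p = cond (\sum_i v i *: b`_i) p.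
  have s_sum : s (\sum_i v i *: b`_i) = \sum_i v i *: s b`_i.
    rewrite (big_morph s (invD s) (Defs.inv0 s)).
    by apply: eq_bigr => i _; rewrite alg_invZ.
  case: p => [[j m]|m] /=.
    rewrite mulr_suml mulr_sumr -sumrB linear_sum; apply: eq_bigr => i _.
    by rewrite -scalerAl -scalerAr -scalerBr linearZ.
  by rewrite s_sum -sumrB linear_sum; apply: eq_bigr => i _; rewrite -scalerBr linearZ.
have [v v0|p|c cE] := @system_scalext F L iota n _ (fun i => cond b`_i)
    (fun i => coord b i 1) _ (fun i => coordL i x).
- have [||c cE] := @sym_centre (\sum_i v i *: b`_i).
  + move=> y; set z := \sum_i _; rewrite (coord_vbasis (memvf y)).
    rewrite mulr_sumr mulr_suml.
    apply: eq_bigr => j _; rewrite -scalerAl -scalerAr; congr (_ *: _).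
    apply/eqP; rewrite -subr_eq0; apply/eqP/coord_eq0 => m.
    by rewrite -[LHS]/(cond _ (inl (j, m))) -cond_sum v0.
  + apply/eqP; rewrite -subr_eq0; apply/eqP/coord_eq0 => m.
    by rewrite -[LHS]/(cond _ (inr m)) -cond_sum v0.
  exists c => i; have := congr1 (coord b i) cE.
  by rewrite linearZ coord_sum_free // (basis_free (vbasisP _)).
- case: p => [[j m]|m] /=.
    have := xC b`_j; rewrite {1 2}[x]scalext_expand mulr_suml mulr_sumr.
    move/eqP; rewrite -subr_eq0 -sumrB => /eqP/(congr1 (coordL m)).
    rewrite coordL_sum coordL0 => eq0; rewrite -[RHS]eq0; apply: eq_bigr => i _.
    by rewrite !smulM mul1r mulr1 -smulNl -smulDl coordL_smul mulrC.
  have := sx; rewrite {1 2}[x]scalext_expand.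
  have -> : scalext_inv iota s (\sum_(i < \dim {:A}) sm b`_i (coordL i x)) =
      \sum_(i < \dim {:A}) sm (s b`_i) (coordL i x).
    rewrite (big_morph _ (invD _) (Defs.inv0 _)); apply: eq_bigr => i _.
    exact: scalext_invE.
  move/eqP; rewrite -subr_eq0 -sumrB => /eqP/(congr1 (coordL m)).
  rewrite coordL_sum coordL0 => eq0; rewrite -[RHS]eq0; apply: eq_bigr => i _.
  by rewrite -smulNl -smulDl coordL_smul mulrC.
exists c; rewrite [x]scalext_expand (coord_vbasis (memvf (1 : A))) smul_suml.
by apply: eq_bigr => i _; rewrite cE smulZ mulrC.
Qed.

End Centre.

Lemma sum_triple (V : nmodType) (I J K : finType) (f : I * (J * K) -> V) :
  \sum_x f x = \sum_i \sum_j \sum_k f (i, (j, k)).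
Proof.
transitivity (\sum_x f (x.1, (x.2.1, x.2.2))); first by apply: eq_bigr => -[i []].
rewrite -(pair_bigA _ (fun i y => f (i, (y.1, y.2)))) /=; apply: eq_bigr => i _.
by rewrite -(pair_bigA _ (fun j k => f (i, (j, k)))).
Qed.

(** * Scalars and traces seen through a Morita bimodule *)

Section ScalarMorita.
Variables (F : fieldType) (L : rcfType) (iota : {rmorphism F -> L}).
Variables (A : falgType F) (s : alg_involution A).
Variables (D : pzRingType) (t : involution D) (a : posalg L t).
Local Notation sL := (scalext_inv iota s).
Variable V : hbimodule sL t false.
Hypothesis V_morita : morita_bimodule V.
Variables (N : nat) (e : 'I_N -> hmod V) (al : 'I_N -> int).
Hypothesis e_basis : orthonormal_basis (h := V) e al.

Local Notation emb := (emb a).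
Local Notation re := (pre a).
Local Notation coord := (@pcoord _ _ _ a).
Local Notation act := (bim_act V).
Local Notation sm := (@smul F L iota A).
Local Notation T := (bim_trace a (V := V) e al).

Let k0 := Ordinal (bim_dim_gt0 a V_morita e_basis).

(* A Morita equivalence need not be L-linear: the scalar l of A (x)_F L acts on
   V as some possibly different scalar tau l of D. *)
Definition scalar_twist (l : L) : L :=
  re ((al k0)%:~R * V (e k0) (act (sm 1 l) (e k0))).

(** [sm 1 l] is central, so it commutes with the rank one operators from [e k0] to each [e k] and
    acts on all [e k] by one element [d] of [D]. It is fixed by the involution, so [d] is symmetric,
    hence a scalar. *)
Lemma scalar_twistE l w : act (sm 1 l) w = w *> emb (scalar_twist l).
Proof.
set d := (al k0)%:~R * V (e k0) (act (sm 1 l) (e k0)).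
have ek k : act (sm 1 l) (e k) = e k *> d.
  have [b bE] := bim_rank_one V_morita (e k) (e k0).
  have := congr1 (fun x => act x (e k0)) (smul1C l b).
  rewrite /= !bim_actM !bE (e_ortho e_basis) eqxx mulr1n bim_actS.
  move=> /(congr1 (fun v => v *> (al k0)%:~R)).
  by rewrite !rscaleA (al_sqr e_basis) rscale1 -(intC a).
have dE : d = emb (scalar_twist l).
  apply: inv_sym; rewrite /d invM -herm_swap -(emb_int a) inv_emb embC bim_adj.
  by rewrite [Defs.inv_fun _ _]scalext_invE Defs.inv1.
rewrite [in LHS](e_expand e_basis w) linear_sum [in RHS](e_expand e_basis w).
rewrite rscale_suml; apply: eq_bigr => k _.
by rewrite bim_actS ek !rscaleA dE embC.
Qed.

Lemma e_emb_inj l l' : e k0 *> emb l = e k0 *> emb l' -> l = l'.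
Proof.
move=> /(congr1 (fun v => re ((al k0)%:~R * V (e k0) v))).
rewrite !hformZr (e_ortho e_basis) eqxx mulr1n !mulrA (al_sqr e_basis).
by rewrite !mul1r !pre_emb.
Qed.

Lemma scalar_twist_is_additive : zmod_morphism scalar_twist.
Proof.
have twistD l l' : scalar_twist (l + l') = scalar_twist l + scalar_twist l'.
  by rewrite /scalar_twist smulDr bim_actD hformDr mulrDr preD.
by move=> l l'; apply/eqP; rewrite -subr_eq opprK -twistD subrK.
Qed.

Lemma scalar_twist_is_monoid_morphism : monoid_morphism scalar_twist.
Proof.
split; first by apply: e_emb_inj; rewrite -scalar_twistE emb1 rscale1; apply: bim_act1.
move=> l l'; apply: e_emb_inj; rewrite -scalar_twistE mulrC.
have -> : sm 1 (l' * l) = sm 1 l' * sm 1 l by rewrite smulM mulr1.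
by rewrite bim_actM !scalar_twistE rscaleA -embM mulrC embM.
Qed.

HB.instance Definition _ := GRing.isZmodMorphism.Build L L scalar_twist
  scalar_twist_is_additive.
HB.instance Definition _ := GRing.isMonoidMorphism.Build L L scalar_twist
  scalar_twist_is_monoid_morphism.

(** Scaling [V] by l commutes with B and is self-adjoint; it therefore comes from a symmetric
    central element of A (x) L, which is some [sm 1 l']. *)
Lemma scalar_twist_surj l : exists l', scalar_twist l' = l.
Proof.
have [||b bE] := bim_endo V_morita (g := fun w => w *> emb l).
- by move=> v w; rewrite rscaleDl.
- by move=> v d; rewrite !rscaleA embC.
have [||l' l'E] := @sym_centre_scalext F L iota A s b.
- move=> x; apply: (bim_act_inj V_morita) => v.
  by rewrite !bim_actM !bE bim_actS.
- apply: (bim_act_inj V_morita) => v; rewrite bE; apply/eqP.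
  rewrite -subr_eq0; apply/eqP/(@hform_eq0 _ _ _ V) => y.
  rewrite hformDr hformNr -bim_adj bE hformZl inv_emb hformZr embC.
  exact: subrr.
by exists l'; apply: e_emb_inj; rewrite -scalar_twistE -l'E bE.
Qed.

Local Notation J := ('I_N * ('I_N * 'I_(pdim a)))%type.

Let psi (j : J) x : L := coord j.2.2 ((al j.1)%:~R * V (e j.1) (act x (e j.2.1))).

(** The [w j] are the matrix units of End_D V with entries in [pbasis], and [psi] gives the matrix
    coordinates. Up to the twist they form an L-basis of A (x) L in which the trace over F can be
    computed. *)
Lemma scalar_twist_trace (E : A -> A) (EL : scalext iota A -> scalext iota A) :
    (forall x y, EL (x + y) = EL x + EL y) ->
    (forall l x, EL (sm 1 l * x) = sm 1 l * EL x) ->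
    (forall x, EL (sm x 1) = sm (E x) 1) ->
  exists w : J -> scalext iota A,
    (forall j v, act (w j) v =
       e j.1 *> pbasis j.2.2 *> ((al j.2.1)%:~R * V (e j.2.1) v)) /\
    scalar_twist (iota (trF E)) = \sum_j psi j (EL (w j)).
Proof.
move=> ELD ELZ ELE.
have /choice[w wE] : forall j : J, exists b, forall v, act b v =
    e j.1 *> pbasis j.2.2 *> ((al j.2.1)%:~R * V (e j.2.1) v).
  move=> j; have [b bE] := bim_rank_one V_morita (e j.1 *> pbasis j.2.2)
    (e j.2.1 *> (al j.2.1)%:~R).
  by exists b => v; rewrite bE hformZl -(emb_int a) inv_emb.
exists w; split=> //.
apply: (@trace_dual_family F L iota A E EL _ L scalar_twist w psi) => //.
- by move=> j x y; rewrite /psi bim_actD hformDr mulrDr pcoordD.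
- move=> j l x; rewrite /psi smul1C bim_actM scalar_twistE bim_actS hformZr.
  by rewrite mulrA -embC pcoordZ.
move=> x; have /choice[c cE] : forall j, exists l', scalar_twist l' = psi j x.
  by move=> j; apply: scalar_twist_surj.
exists c => //; apply: (bim_act_inj V_morita) => v.
have act_sum (f : J -> scalext iota A) : act (\sum_j f j) v = \sum_j act (f j) v.
  apply: (big_morph (fun y => act y v)) => [y z|]; first exact: bim_actD.
  by apply: (addrI (act 0 v)); rewrite -bim_actD !addr0.
rewrite act_sum sum_triple exchange_big /= [in LHS](e_expand e_basis v) linear_sum.
apply: eq_bigr => l _; rewrite bim_actS [act x _](e_expand e_basis).
rewrite rscale_suml; apply: eq_bigr => k _.
rewrite [in LHS](pcoordE a ((al k)%:~R * _)) rscale_sumr rscale_suml.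
apply: eq_bigr => p _; rewrite bim_actM scalar_twistE cE wE /= !rscaleA.
by rewrite -[LHS]/(_ *> (_ * _ * _)) -[in LHS]mulrA embC -[in LHS]mulrA.
Qed.

Definition regular_trace (x : A) : F := trF (fun y => x * y).

(** Left multiplication acts separately on the [N] columns of a matrix, and the L-trace of left
    multiplication by d on [D] is [pdim a] times its real part. *)
Lemma regular_trace_twist x : scalar_twist (iota (regular_trace x)) =
  (N * pdim a)%:R * T (sm x 1).
Proof.
have [| | |w [wE ->]] := @scalar_twist_trace (fun y => x * y) (fun y => sm x 1 * y).
- by move=> y z; rewrite mulrDr.
- by move=> l y; rewrite !mulrA smul1C.
- by move=> y; rewrite smulM mulr1.
rewrite sum_triple /bim_trace mulr_sumr; apply: eq_bigr => k _.
rewrite natrM -mulrA -ptrace mulr_natl -[N in RHS]card_ord -sumr_const.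
apply: eq_bigr => l _; apply: eq_bigr => p _.
rewrite /psi /= bim_actM wE /= (e_ortho e_basis) eqxx mulr1n (al_sqr e_basis).
by rewrite rscale1 bim_actS hformZr mulrA.
Qed.

(** The adjoint involution exchanges the matrix positions (k, l) and (l, k) up to sign, so only the
    [N] diagonal positions contribute, each with the trace of [t] on [D]. *)
Lemma involution_trace_twist : scalar_twist (iota (trF s)) = (N%:Z * pkappa a)%:~R.
Proof.
have [| | |w [wE ->]] := @scalar_twist_trace s sL.
- exact: invD.
- move=> l y; rewrite invM smul1C; congr (_ * _).
  by rewrite [LHS]scalext_invE Defs.inv1.
- by move=> y; rewrite [LHS]scalext_invE.
rewrite sum_triple intrM -ptrace_inv -pmulrn mulr_natl -[N in RHS]card_ord -sumr_const.
apply: eq_bigr => k _.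
rewrite (bigD1 k) //= [X in _ + X]big1 ?addr0.
  apply: eq_bigr => p _; rewrite /psi /= -bim_adj wE /=.
  rewrite (e_ortho e_basis) eqxx mulr1n (al_sqr e_basis) rscale1 hformZl.
  rewrite (e_ortho e_basis) eqxx mulr1n -(intC a) mulrA (al_sqr e_basis).
  by rewrite mul1r.
move=> l lk; rewrite big1 // => p _; rewrite /psi /= -bim_adj wE /=.
by rewrite (e_ortho e_basis) (negPf lk) mulr0 rscale0 hform0l mulr0 pcoord0.
Qed.

End ScalarMorita.

(** * The trace form after passage to a real closure *)

Section TraceForm.
Variables (F : fieldType) (L : rcfType) (iota : {rmorphism F -> L}).
Variables (A : falgType F) (s : alg_involution A).
Variables (D : pzRingType) (t : involution D) (a : posalg L t).
Local Notation AL := (scalext iota A).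
Local Notation sL := (scalext_inv iota s).
Variable V : hbimodule sL t false.
Hypothesis V_morita : morita_bimodule V.
Variables (N : nat) (e : 'I_N -> hmod V) (al : 'I_N -> int).
Hypothesis e_basis : orthonormal_basis (h := V) e al.

Local Notation emb := (emb a).
Local Notation re := (pre a).
Local Notation act := (bim_act V).
Local Notation sm := (@smul F L iota A).
Local Notation T := (bim_trace a (V := V) e al).
Local Notation tau := (scalar_twist a V_morita e_basis).

Variables h h0 : hform s false.
Local Notation hL := (base_change iota h).
Local Notation h0L := (base_change iota h0).
Local Notation q := (pair_form re (h := htens V hL) (h0 := htens V h0L)).
Local Notation btm h := (tmul (@rscale A (hmod h)) (bim_act (bc_bimodule iota s))).

Definition scalext_elt (k : hform s false) (x : hmod k) : hmod (base_change iota k) :=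
  btm k x (1 : AL).

Lemma scalext_eltZ (k : hform s false) (x : hmod k) (b : AL) :
  scalext_elt x *> b = btm k x b.
Proof.
rewrite /scalext_elt [LHS]tmul_rscale; congr tmul; exact: (mul1r b).
Qed.

Lemma scalext_elt_smul (k : hform s false) (x : hmod k) c l :
  scalext_elt x *> sm c l = scalext_elt (x *> c) *> sm 1 l.
Proof.
rewrite !scalext_eltZ tmul_bal; congr tmul.
by rewrite /= /bc_act /scalext_in smulM mulr1 mul1r.
Qed.

Lemma scalext_elt_val (k : hform s false) (x y : hmod k) :
  base_change iota k (scalext_elt x) (scalext_elt y) = sm (k x y) 1.
Proof.
rewrite [LHS]htens_valE /= /unit_form_val /bc_act Defs.inv1 mul1r.
exact: mulr1.
Qed.

Definition trace_dual (x : hmod h * hmod h0) :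
    seq (L * (hmod (htens V hL) * hmod (htens V h0L))) :=
  pair_dual L e al (scalext_elt x.1, scalext_elt x.2).

Lemma trace_dualE x y : tau (iota (pair_form (@regular_trace F A) x y)) =
  (N * pdim a)%:R * blsum q (trace_dual x) (trace_dual y).
Proof.
rewrite regular_trace_twist; congr (_ * _).
rewrite -(pair_dualE a e_basis) /pair_form; congr bim_trace.
by rewrite !scalext_elt_val smulM mulr1.
Qed.

(** On pure tensors, elements of A (x) L are first moved into [V], and [pair_dual_span] provides a
    [b] in A (x) L. Writing [b] as a sum of [sm c l], the factor c is absorbed into the point x of
    [h], and l becomes the coefficient [tau l]. *)
Lemma trace_dual_span u : exists r : seq (L * (hmod h * hmod h0)), forall w,
  q u w = lsum (fun x => lsum (q^~ w) (trace_dual x)) r.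
Proof.
case: u => u u0.
pose S (u : hmod (htens V hL)) (u0 : hmod (htens V h0L)) :=
  exists r : seq (L * (hmod h * hmod h0)), forall w,
  q (u, u0) w = lsum (fun x => lsum (q^~ w) (trace_dual x)) r.
rewrite -/(S u u0).
have SDl x x' y : S x y -> S x' y -> S (x + x') y.
  move=> [r rE] [r' r'E]; exists (r ++ r') => w.
  by rewrite pair_formDl rE r'E lsum_cat.
have SDr x y y' : S x y -> S x y' -> S x (y + y').
  move=> [r rE] [r' r'E]; exists (r ++ r') => w.
  by rewrite pair_formDr rE r'E lsum_cat.
elim/tens_ind: u => [X v|x x' Sx Sx']; last exact: SDl.
elim/tens_ind: X => [x xi|x x' Sx Sx']; last by rewrite tmulDl; apply: SDl.
elim/tens_ind: u0 => [Y v0|y y' Sy Sy']; last exact: SDr.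
elim/tens_ind: Y => [y eta|y y' Sy Sy']; last by rewrite tmulDl; apply: SDr.
rewrite -!scalext_eltZ !tmul_bal.
have [b bE] := pair_dual_span a V_morita e_basis (scalext_elt x) (scalext_elt y)
  (act xi v) (act eta v0).
have [r bE'] := smul_ind b.
exists [seq (tau p.2, (x *> p.1, y)) | p <- r] => w.
transitivity (\sum_(p <- r) tau p.2 *
    lsum (q^~ w) (trace_dual (x *> p.1, y))); last by rewrite /lsum big_map.
rewrite bE lsum_pair_dual.
under [RHS]eq_bigr => p _ do rewrite lsum_pair_dual mulr_sumr.
rewrite exchange_big; apply: eq_bigr => k _ /=.
rewrite bE' rscale_sumr.
set yk := tmul _ _ (scalext_elt y) (e k).
have -> : tmul (@rscale AL (hmod hL)) act
      (\sum_(p <- r) scalext_elt x *> sm p.1 p.2) (e k) =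
    \sum_(p <- r) tmul (@rscale AL (hmod hL)) act
      (scalext_elt (x *> p.1)) (e k) *> emb (tau p.2).
  rewrite (big_morph (fun X => tmul _ _ X _)
    (fun x y => tmulDl _ _ x y _) (tmul0l _ _ _)).
  apply: eq_bigr => p _; rewrite scalext_elt_smul tmul_bal.
  by rewrite (scalar_twistE a V_morita e_basis) tmul_rscale.
have -> f : q (\sum_(p <- r) f p, yk) w = \sum_(p <- r) q (f p, yk) w.
  apply: (big_morph (fun u => q (u, _) w)) => [u u'|]; first exact: pair_formDl.
  by rewrite /pair_form /= [htens_val 0 _](hform0l (h := htens V hL)) mul0r pre0.
rewrite mulr_sumr; apply: eq_bigr => p _.
by rewrite pair_formZ mulrCA.
Qed.

Lemma trace_form_sig n n0 (be : 'I_n -> int) (be0 : 'I_n0 -> int) :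
    (forall i, be i = 1 \/ be i = -1) -> (forall i, be0 i = 1 \/ be0 i = -1) ->
    diagonalization (htens V hL) be -> diagonalization (htens V h0L) be0 ->
  has_sig (fun x y : hmod h * hmod h0 =>
      tau (iota (pair_form (@regular_trace F A) x y)))
    ((pdim a)%:Z * (\sum_i be i) * (\sum_j be0 j)).
Proof.
move=> be1 be01 hbe h0be0.
apply: (@eq_has_sig _ _ (fun x y => (N * pdim a)%:R *
    blsum q (trace_dual x) (trace_dual y))) => [x y|].
  by rewrite trace_dualE.
apply: has_sigZ.
  by rewrite ltr0n muln_gt0 pdim_gt0 (bim_dim_gt0 a V_morita e_basis).
apply: (has_sig_transport (J := trace_dual) (q := q)) => //.
  exact: trace_dual_span.
exact: pair_form_sig.
Qed.

End TraceForm.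

(** * Witt invariance of the trace form *)

Lemma regular_traceC (F : fieldType) (A : falgType F) (x y : A) :
  regular_trace (x * y) = regular_trace (y * x).
Proof.
have trM (u v : A) : regular_trace (u * v) = \sum_(i < \dim {:A}) \sum_(j < \dim {:A})
    coord (vbasis {:A}) j (v * (vbasis {:A})`_i) *
    coord (vbasis {:A}) i (u * (vbasis {:A})`_j).
  apply: eq_bigr => i _; rewrite -mulrA {1}(coord_vbasis (memvf (v * _))).
  rewrite mulr_sumr linear_sum; apply: eq_bigr => j _.
  by rewrite -scalerAr linearZ.
rewrite !trM exchange_big; apply: eq_bigr => i _; apply: eq_bigr => j _.
exact: mulrC.
Qed.

Lemma regular_traceD (F : fieldType) (A : falgType F) (x y : A) :
  regular_trace (x + y) = regular_trace x + regular_trace y.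
Proof.
rewrite /regular_trace /trF -big_split; apply: eq_bigr => i _.
by rewrite mulrDl linearD.
Qed.

Lemma regular_traceN (F : fieldType) (A : falgType F) (x : A) :
  regular_trace (- x) = - regular_trace x.
Proof.
rewrite /regular_trace /trF -sumrN; apply: eq_bigr => i _.
by rewrite mulNr linearN.
Qed.

Lemma regular_traceZ (F : fieldType) (A : falgType F) c (x : A) :
  regular_trace (c *: x) = c * regular_trace x.
Proof.
rewrite /regular_trace /trF mulr_sumr; apply: eq_bigr => i _.
by rewrite -scalerAl linearZ.
Qed.

Lemma regular_trace_sum (F : fieldType) (A : falgType F) (I : Type) (r : seq I)
    (f : I -> A) :
  regular_trace (\sum_(i <- r) f i) = \sum_(i <- r) regular_trace (f i).
Proof.
apply: (big_morph _ (@regular_traceD F A)).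
by rewrite /regular_trace /trF big1 // => i _; rewrite mul0r linear0.
Qed.

Section WittInvariance.
Variables (F : fieldType) (A : falgType F) (s : alg_involution A).
Hypothesis trV : forall x : A, regular_trace (s x) = regular_trace x.
Variables (R : realFieldType) (k : {rmorphism F -> R}).

Local Notation tr := (@regular_trace F A).
Local Notation q h h0 := (pair_form tr (h := h) (h0 := h0)).

Lemma pair_formC (h h0 : hform s false) x y : q h h0 x y = q h h0 y x.
Proof.
rewrite /pair_form (herm_swap x.1 y.1) (herm_swap y.2 x.2) -invM trV.
exact: regular_traceC.
Qed.

Lemma pair_form_finite_rank (h h0 : hform s false) :
  exists I : finType, finite_rank (q h h0) I.
Proof.
have [I [u [v uv]]] := hform_dual_basis h.
have [I0 [u0 [v0 uv0]]] := hform_dual_basis h0.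
exists (I * (I0 * 'I_(\dim {:A})))%type.
exists (fun (j : I * (I0 * 'I_(\dim {:A}))) x =>
  coord (vbasis {:A}) j.2.2 (h0 (v0 j.2.1) x.2 * h x.1 (u j.1))).
exists (fun (j : I * (I0 * 'I_(\dim {:A}))) y =>
  tr ((vbasis {:A})`_j.2.2 * (h (v j.1) y.1 * h0 y.2 (u0 j.2.1)))).
move=> x y; rewrite sum_triple /pair_form {1}(uv y.1) hform_sumr mulr_suml.
rewrite regular_trace_sum; apply: eq_bigr => i _.
rewrite {1}(uv0 x.2) hform_sumr mulr_sumr regular_trace_sum.
apply: eq_bigr => j _ /=; rewrite !hformZr mulrA regular_traceC.
rewrite -[h x.1 _ * _ * _]mulrA [X in tr X]mulrA.
set X := h0 _ _ * h _ _; set Y := h _ _ * h0 _ _.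
rewrite {1}(coord_vbasis (memvf X)) mulr_suml regular_trace_sum.
by apply: eq_bigr => m _; rewrite -scalerAl regular_traceZ.
Qed.

Lemma pair_form_diag (h h0 : hform s false) :
  exists n (d : 'I_n -> F), diag_form (q h h0) d.
Proof.
have [I rI] := pair_form_finite_rank h h0.
apply: diag_form_exists rI; last exact: pair_formC.
by rewrite -(fmorph_eq0 k) rmorph_nat pnatr_eq0.
Qed.

Definition trace_sig (h h0 : hform s false) (z : int) : Prop :=
  has_sig (fun x y => k (q h h0 x y)) z.

Lemma trace_sig_exists h h0 : exists z, trace_sig h h0 z.
Proof.
have [n [d qd]] := pair_form_diag h h0.
exists (\sum_j sgz (k (d j))), 'I_n, (fun j => k (d j)); split=> //.
exact: diag_form_map.
Qed.

Lemma trace_sigC h h0 z : trace_sig h h0 z -> trace_sig h0 h z.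
Proof.
apply: (@has_sig_surj _ _ _ _ _ (fun x => (x.2, x.1)) (fun x => (x.2, x.1))).
  by case.
move=> x y; rewrite pair_formC /pair_form /=; congr (k _).
by rewrite regular_traceC.
Qed.

Lemma trace_sig_iso h h' h0 z :
  Defs.isometry h h' -> trace_sig h h0 z -> trace_sig h' h0 z.
Proof.
move=> f; have [g fK gK] := iso_bij f.
apply: (@has_sig_surj _ _ _ _ _ (fun x => (g x.1, x.2)) (fun x => (f x.1, x.2))).
  by case=> x y /=; rewrite fK.
by move=> x y; rewrite /pair_form /= -(iso_val f) !gK.
Qed.

Lemma trace_sig_sum h h' h0 z z' : trace_sig h h0 z -> trace_sig h' h0 z' ->
  trace_sig (hsum h h') h0 (z + z').
Proof.
apply: (@has_sig_sum _ _ _ _ _ _ _ (fun x => ((x.1, 0), x.2)) (fun x => ((0, x.1), x.2))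
  (fun x => (x.1.1, x.2)) (fun x => (x.1.2, x.2))) => [[]//|[]//|x y|x y|x y].
- rewrite /pair_form -rmorphD -regular_traceD; congr (k (tr _)); exact: mulrDl.
- by rewrite /pair_form /= hform0l mul0r -[0](scale0r 0) regular_traceZ mul0r rmorph0.
- by rewrite /pair_form /= hform0l mul0r -[0](scale0r 0) regular_traceZ mul0r rmorph0.
Qed.

(* Changing the sign of one of the two summands turns a hyperbolic form into
   its opposite. *)
Lemma trace_sig_hyperbolic h h0 z : hyperbolic h -> trace_sig h h0 z -> z = 0.
Proof.
move=> [U [W [b [_ [bDl bDr bZ _] [f [[g fK gK] fE]]]]]] hz.
have b0 u : b 0 u = 0 by apply: (addrI (b 0 u)); rewrite -bDl !addr0.
have bN w u : b (- w) u = - b w u.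
  by apply: (addrI (b w u)); rewrite -bDl !subrr b0.
pose m x := g ((f x).1, - (f x).2).
have mK : involutive m by move=> x; rewrite /m gK /= opprK -surjective_pairing fK.
have mE x y : h (m x) (m y) = - h x y.
  by rewrite !fE /m !gK /= !bN invN mulrN opprD.
suff /has_sig_uniq/(_ hz) : trace_sig h h0 (- z) by lia.
have := has_sigN hz.
apply: (@has_sig_surj _ _ _ _ _ (fun x => (m x.1, x.2)) (fun x => (m x.1, x.2))).
  by case=> x y; rewrite /= mK.
by move=> x y; rewrite /pair_form /= mE mulNr regular_traceN rmorphN opprK.
Qed.

Lemma trace_sig_witt h h' h0 z : witt_equiv h h' ->
  trace_sig h h0 z -> trace_sig h' h0 z.
Proof.
move=> [j [j' [hj hj' [f]]]] hz.
have [y jy] := trace_sig_exists j h0; have [y' jy'] := trace_sig_exists j' h0.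
have [z' hz'] := trace_sig_exists h' h0.
have y0 := trace_sig_hyperbolic hj jy; have y'0 := trace_sig_hyperbolic hj' jy'.
rewrite {}y0 in jy; rewrite {}y'0 in jy'.
have /(has_sig_uniq (trace_sig_sum hz' jy')) := trace_sig_iso f (trace_sig_sum hz jy).
by rewrite !addr0 => <-.
Qed.

Lemma trace_sig_class (w w0 : witt s false) h h' h0 h0' z z' :
  w h -> w h' -> w0 h0 -> w0 h0' ->
  trace_sig h h0 z -> trace_sig h' h0' z' -> z = z'.
Proof.
have [g gP] := witt_classP w; have [g0 g0P] := witt_classP w0.
move=> /gP gh /gP gh' /g0P g0h /g0P g0h' hz h'z'.
have [y gy] := trace_sig_exists g g0.
have sig_y j j0 : witt_equiv g j -> witt_equiv g0 j0 -> trace_sig j j0 y.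
  move=> gj g0j; apply/(trace_sig_witt gj)/trace_sigC.
  exact/(trace_sig_witt g0j)/trace_sigC.
rewrite (has_sig_uniq hz (sig_y _ _ gh g0h)).
by rewrite (has_sig_uniq h'z' (sig_y _ _ gh' g0h')).
Qed.

End WittInvariance.

(** The trace form is diagonalized over F itself, and both embeddings give a diagonal entry the sign
    that P prescribes. *)
Lemma trace_sig_transfer (F : fieldType) (A : falgType F) (s : alg_involution A)
    (trV : forall x : A, regular_trace (s x) = regular_trace x) (P : ordering F)
    (R R' : realFieldType) (k : {rmorphism F -> R}) (k' : {rmorphism F -> R'})
    (h h0 : hform s false) z :
    (forall x, P x -> 0 <= k x) -> (forall x, P x -> 0 <= k' x) ->
  trace_sig k h h0 z -> trace_sig k' h h0 z.
Proof.
move=> Pk Pk' hz.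
have [n [d qd]] := pair_form_diag trV k h h0.
exists 'I_n, (fun j => k' (d j)); split; first exact: diag_form_map.
have kz : trace_sig k h h0 (\sum_j sgz (k (d j))).
  by exists 'I_n, (fun j => k (d j)); split=> //; apply: diag_form_map.
rewrite (has_sig_uniq hz kz).
have sgE (T : realFieldType) (f : {rmorphism F -> T}) x : (forall x, P x -> 0 <= f x) ->
    sgz (f x) = if x == 0 then 0 else if `[< P x >] then 1 else -1.
  move=> Pf; have [->|x0] := eqVneq x 0; first by rewrite rmorph0 sgz0.
  case: asboolP => [Px|nPx].
    by rewrite gtr0_sgz // lt0r fmorph_eq0 x0 Pf.
  have [//|Px] := ord_total P x.
  by rewrite ltr0_sgz // lt_neqAle fmorph_eq0 x0 -oppr_ge0 -rmorphN Pf.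
by apply: eq_bigr => j _; rewrite !sgE.
Qed.

(** * Comparison of signatures *)

Lemma diagonalization_iso (D : pzRingType) (t : involution D) (e : bool)
    (h h' : hform t e) n (al : 'I_n -> int) :
  Defs.isometry h h' -> diagonalization h al -> diagonalization h' al.
Proof.
move=> f [phi [phi_bij phiE]]; have [g fK gK] := iso_bij f.
have g_lin : linear g by apply: can2_linear gK.
pose gl : {linear hmod h' -> hmod h} :=
  HB.pack g (GRing.isLinear.Build D^c (hmod h') (hmod h) _ g g_lin).
exists (phi \o gl); split.
  by apply: bij_comp phi_bij _; exists f.
by move=> x y; rewrite /= -phiE -(iso_val f) !gK.
Qed.

(** The embedding [k] is [tau \o iota]; a square of L goes to a square under [tau], whence the first
    clause. Invariance of the trace under [s] is also read off from [V]: over L it becomes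
    invariance of the trace on [V] under taking adjoints. *)
Lemma morita_trace_sig (F : fieldType) (L : rcfType) (iota : {rmorphism F -> L})
    (A : falgType F) (s : alg_involution A) (D : pzRingType) (t : involution D)
    (a : posalg L t) (M : morita_equiv (scalext_inv iota s) t false) :
  exists k : {rmorphism F -> L},
    [/\ forall x, (exists y, iota x = y ^+ 2) -> 0 <= k x,
        forall x : A, regular_trace (s x) = regular_trace x,
        exists2 N, (0 < N)%N & k (trF s) = (N%:Z * pkappa a)%:~R
      & forall h h0, trace_sig k h h0 ((pdim a)%:Z *
          diag_sign (M (base_change iota h)) * diag_sign (M (base_change iota h0)))].
Proof.
have [V [V_morita [eta _]]] := morita_given M.
have [N [e [al e_basis]]] := hform_diag a V.
pose tau := scalar_twist a V_morita e_basis.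
exists (tau \o iota); split.
- by move=> x [y xy]; rewrite /= xy rmorphXn sqr_ge0.
- move=> x; apply: (fmorph_inj (tau \o iota)) => /=.
  rewrite !regular_trace_twist; congr (_ * _).
  have <- : scalext_inv iota s (smul iota x 1) = smul iota (s x) 1.
    exact: scalext_invE.
  exact: bim_traceV.
- exists N; first exact (bim_dim_gt0 a V_morita e_basis).
  exact: involution_trace_twist.
move=> h h0.
have [n [be [be1 hbe ->]]] := diag_signP a (M (base_change iota h)).
have [n0 [be0 [be01 h0be ->]]] := diag_signP a (M (base_change iota h0)).
exact: trace_form_sig be1 be01 (diagonalization_iso (eta _) hbe)
  (diagonalization_iso (eta _) h0be).
Qed.

Definition DP_dim (k : dkind) : nat :=
  match k with DReal => 1 | DComplex => 2 | DQuat => 4 | DSplit => 0 end.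

Definition DP_kappa (k : dkind) : int :=
  match k with DReal => 1 | DComplex => 0 | DQuat => -2 | DSplit => 0 end.

Lemma Dring_posalg (k : dkind) (L : rcfType) : k <> DSplit ->
  {a : posalg L (Dinv k L) | (pdim a, pkappa a) = (DP_dim k, DP_kappa k)}.
Proof.
case: k => //= _.
- exact: real_posalg.
- exact: complex_posalg.
- exact: quat_posalg.
Qed.

Lemma morita_sign (F : fieldType) (L : rcfType) (iota : {rmorphism F -> L})
    (A : falgType F) (s : alg_involution A) (k : dkind) (e : bool)
    (M : morita_equiv (scalext_inv iota s) (Dinv k L) e) :
    k <> DSplit -> e = false ->
  exists f : {rmorphism F -> L},
    [/\ forall x, (exists y, iota x = y ^+ 2) -> 0 <= f x,
        forall x : A, regular_trace (s x) = regular_trace x,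
        exists2 N, (0 < N)%N & f (trF s) = (N%:Z * DP_kappa k)%:~R
      & forall h h0, trace_sig f h h0 ((DP_dim k)%:Z *
          sign (M (base_change iota h)) * sign (M (base_change iota h0)))].
Proof.
move=> kS e0; subst e.
have [a [<- <-]] := Dring_posalg L kS.
have signE (h : hform (Dinv k L) false) : sign h = diag_sign h by case: (k) kS h.
have [f [f1 f2 f3 f4]] := morita_trace_sig a M.
by exists f; split=> // h h0; rewrite !signE.
Qed.

Section SignWitt.
Variables (F : fieldType) (A : falgType F) (s : alg_involution A).
Variable P : ordering F.
Variables (L : rcfType) (iota : {rmorphism F -> L}).
Hypothesis hL : real_closure P iota.

Lemma not_nil_ordering : ~ nil_ordering s P ->
  DP_kind s P iota <> DSplit /\ epsP s P iota = false.
Proof.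
move=> hP; have nil3 : ~ [\/ Defs.orthogonal s /\ DP_kind s P iota = DQuat,
    symplectic s /\ DP_kind s P iota = DReal |
    unitary s /\ DP_kind s P iota = DSplit].
  by move=> n3; apply: hP; exists L, iota.
split=> [kS|].
  apply: nil3; constructor 3; split=> //.
  move: kS; rewrite /DP_kind; case: asboolP => // _.
  case: asboolP => [[d ds _] _|_]; first by exists d.
  by case: asboolP.
rewrite /epsP; case kE: (DP_kind s P iota) => //; apply/asboolP => os; apply: nil3.
  by constructor 2.
by constructor 1.
Qed.

Lemma sign_wittP (M : morita_at s P iota) (w : witt s false) :
  (exists h, w h) -> exists2 h, w h & sign_witt M w = sign_form M h.
Proof.
move=> [h wh]; rewrite /sign_witt; set S := (X in xget 0 X).
have : S (xget 0 S) by apply: (xgetPex 0 (P := S)); exists (sign_form M h), h.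
by [].
Qed.

(** The value on an empty class is the default 0 of [xget]; in the theorem this case is separated
    off at the start. *)
Lemma sign_witt0 (M : morita_at s P iota) (w : witt s false) :
  ~ (exists h, w h) -> sign_witt M w = 0.
Proof.
move=> nw; rewrite /sign_witt; set S := (X in xget 0 X).
by apply: xgetPN => z [h wh _]; apply: nw; exists h.
Qed.

End SignWitt.

Theorem lemma3p8 (F : fieldType) (hF : formally_real F)
    (A : falgType F) (s : alg_involution A)
    (P : ordering F) (hP : ~ nil_ordering s P)
    (L1 L2 : rcfType)
    (iota1 : {rmorphism F -> L1}) (iota2 : {rmorphism F -> L2})
    (hL1 : real_closure P iota1) (hL2 : real_closure P iota2)
    (M1 : morita_at s P iota1) (M2 : morita_at s P iota2)
    (h0 : witt s false) (hh0 : sign_witt M1 h0 <> 0)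
    (h : witt s false) :
  Num.sg (sign_witt M1 h0) * sign_witt M1 h =
  Num.sg (sign_witt M2 h0) * sign_witt M2 h.
Proof.
have [h0_rep|/(sign_witt0 M1)//] := pselect (exists g, h0 g).
have [h_rep|nh] := pselect (exists g, h g); last first.
  by rewrite (sign_witt0 M1 nh) (sign_witt0 M2 nh) !mulr0.
have [kS1 e1] := not_nil_ordering hL1 hP; have [kS2 e2] := not_nil_ordering hL2 hP.
have [f1 [P1 trV [N1 N1_gt0 tr1] sig1]] := morita_sign M1 kS1 e1.
have [f2 [P2 _ [N2 N2_gt0 tr2] sig2]] := morita_sign M2 kS2 e2.
have pos1 x : P x -> 0 <= f1 x by move=> Px; apply/P1/hL1.1.
have pos2 x : P x -> 0 <= f2 x by move=> Px; apply/P2/hL2.1.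
(* [L1] and [L2] are unrelated, so the two integers are compared through the trace of [s] in F. As
   [N1] and [N2] are positive, the sign of the integer tells the values 1, 0 and -2 apart. *)
have kk : DP_kind s P iota1 = DP_kind s P iota2.
  have : N1%:Z * DP_kappa (DP_kind s P iota1) = N2%:Z * DP_kappa (DP_kind s P iota2).
    have trE : trF s = (N1%:Z * DP_kappa (DP_kind s P iota1))%:~R.
      by apply: (fmorph_inj f1); rewrite tr1 rmorph_int.
    by move: tr2; rewrite trE rmorph_int => /intr_inj.
  by case: DP_kind kS1 => // _; case: DP_kind kS2 => // _ /=; lia.
have c_gt0 : (DP_dim (DP_kind s P iota2))%:Z != 0 by case: DP_kind kS2.
have sig_eq (w w0 : witt s false) g g0 g' g0' : w g -> w g' -> w0 g0 -> w0 g0' ->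
    sign_form M1 g * sign_form M1 g0 = sign_form M2 g' * sign_form M2 g0'.
  move=> wg wg' w0g0 w0g0'; apply: (mulfI c_gt0); rewrite -{1}kk !mulrA.
  apply: (trace_sig_class trV (k := f2) wg wg' w0g0 w0g0'); last exact: sig2.
  exact: trace_sig_transfer trV P _ _ f1 f2 g g0 _ pos1 pos2 (sig1 g g0).
(* The two signatures of a class may be taken at different representatives; [sig_eq] allows for
   this. *)
have [g1 hg1 s1] := sign_wittP M1 h_rep; have [g2 hg2 s2] := sign_wittP M2 h_rep.
have [g01 hg01 s01] := sign_wittP M1 h0_rep.
have [g02 hg02 s02] := sign_wittP M2 h0_rep.
have := sig_eq _ _ _ _ _ _ hg01 hg02 hg1 hg2.
have := sig_eq _ _ _ _ _ _ hg01 hg02 hg01 hg02.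
rewrite -s1 -s2 -s01 -s02 -!expr2 => sq prod.
have x0 : sign_witt M1 h0 != 0 by apply/eqP.
move/eqP: sq; rewrite eqf_sqr => /orP[]/eqP x0E; apply: (mulfI x0).
  by rewrite mulrCA prod [RHS]mulrCA x0E.
by rewrite mulrCA prod [RHS]mulrCA x0E sgrN !mulNr mulrN.
Qed.
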